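(* The mapping $\mu\mapsto[\mu]$, sending a valuation to its equivalence class, induces a bijection between $\mathcal T_{\mathrm{sme}}$ and $\mathcal T_v$.
   Context: Valuations. For an ordered abelian group $\Lambda$ write $\Lambda\infty=\Lambda\cup\{\infty\}$. A valuation on a commutative ring $A$ is a map $\mu\colon A\to\Lambda\infty$ (for some ordered abelian group $\Lambda$) with $\mu(1)=0$, $\mu(0)=\infty$, $\mu(ab)=\mu(a)+\mu(b)$, $\mu(a+b)\ge\min\{\mu(a),\mu(b)\}$. Its support is the prime ideal $\mathfrak p=\mu^{-1}(\infty)$; its value group $\Gamma_\mu$ is the subgroup of $\Lambda$ generated by $\mu(A\setminus\mathfrak p)$. Two valuations $\mu,\nu$ on $A$ are equivalent, $\mu\sim\nu$, if there is an isomorphism of ordered groups $\iota\colon\Gamma_\mu\to\Gamma_\nu$ with $\nu=\iota\circ\mu$; $[\mu]$ is the equivalence class of $\mu$. Base field and the universal group. $(K,v)$ is a valued field with value group $\Gamma=v(K^* )$ and $\Gamma_{\mathbb Q}=\Gamma\otimes\mathbb Q$. Let $I$ be a totally ordered set indexing the nonzero principal convex subgroups $H_i$ of $\Gamma_{\mathbb Q}$ (those generated, as convex subgroups, by one element), with $i<j\iff H_i\supsetneq H_j$. Let $H_i^*$ be the maximal proper convex subgroup of $H_i$ and $Q_i=H_i/H_i^*$. The Hahn products $\mathbf H(\Gamma_{\mathbb Q})\subset\prod_{i\in I}Q_i$ and $\mathbb R^I_{\mathrm{lex}}\subset\mathbb R^I$ consist of the elements with well-ordered support, with the lexicographical order.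 Fix a Hahn $\mathbb Q$-linear order embedding $\Gamma_{\mathbb Q}\hookrightarrow\mathbf H(\Gamma_{\mathbb Q})$ inducing an isomorphism of skeletons, and order embeddings $Q_i\hookrightarrow\mathbb R$ sending a chosen positive element to $1$; through the composition $\Gamma\hookrightarrow\Gamma_{\mathbb Q}\hookrightarrow\mathbf H(\Gamma_{\mathbb Q})\hookrightarrow\mathbb R^I_{\mathrm{lex}}$ we regard $\Gamma\subset\Gamma_{\mathbb Q}\subset\mathbb R^I_{\mathrm{lex}}$ as subgroups, so $v$ takes values in $\mathbb R^I_{\mathrm{lex}}$. Let $\mathrm{Init}(I)$ be the set of initial segments of $I$ (including $\emptyset$ and $I$). For $S\in\mathrm{Init}(I)$ let $i_S$ be a formal symbol and $I_S=S+\{i_S\}+(I\setminus S)$ (ordered sum). Let $\mathbb I=I\cup\{i_S\mid S\in\mathrm{Init}(I)\}$ with the total order such that each inclusion $I_S\hookrightarrow\mathbb I$ preserves the order, and $i_S<i_T$ iff $S\subsetneq T$. Let $\mathbb R^{\mathbb I}_{\mathrm{lex}}$ and $\mathbb R^{I_S}_{\mathrm{lex}}$ be the analogous Hahn products; extension by zero gives embeddings $\mathbb R^I_{\mathrm{lex}}\subset\mathbb R^{I_S}_{\mathrm{lex}}\subset\mathbb R^{\mathbb I}_{\mathrm{lex}}$. Put $\mathbb R_{\mathrm{sme}}=\bigcup_{S\in\mathrm{Init}(I)}\mathbb R^{I_S}_{\mathrm{lex}}\subset\mathbb R^{\mathbb I}_{\mathrm{lex}}$. For $\beta,\gamma\in\mathbb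 R_{\mathrm{sme}}$, write $\beta\sim_{\mathrm{sme}}\gamma$ if there is an isomorphism of ordered groups $\langle\Gamma,\beta\rangle\to\langle\Gamma,\gamma\rangle$ which is the identity on $\Gamma$ and sends $\beta$ to $\gamma$. Let $\Gamma_{\mathrm{sme}}\subset\mathbb R_{\mathrm{sme}}$ be a fixed set of representatives of the quotient $\mathbb R_{\mathrm{sme}}/\!\sim_{\mathrm{sme}}$; necessarily $\Gamma_{\mathbb Q}\subset\Gamma_{\mathrm{sme}}$. Key polynomials. For a valuation $\mu$ on $K[x]$ with support $\mathfrak p$ and $\alpha\in\Gamma_\mu$ let $\mathcal P_\alpha=\{g\mid\mu(g)\ge\alpha\}$, $\mathcal P_\alpha^+=\{g\mid\mu(g)>\alpha\}$; the graded algebra is $\mathcal G_\mu=\bigoplus_{\alpha\in\Gamma_\mu}\mathcal P_\alpha/\mathcal P_\alpha^+$. The initial term is $\mathrm{in}_\mu g=g+\mathcal P^+_{\mu(g)}$ for $g\notin\mathfrak p$, and $\mathrm{in}_\mu g=0$ for $g\in\mathfrak p$. Write $h\mid_\mu g$ if $\mathrm{in}_\mu h$ divides $\mathrm{in}_\mu g$ in $\mathcal G_\mu$. A polynomial $g$ is $\mu$-irreducible if $(\mathrm{in}_\mu g)\mathcal G_\mu$ is a nonzero prime ideal, and $\mu$-minimal if $g\nmid_\mu f$ for all nonzero $f$ with $\deg f<\deg g$. A key polynomial for $\mu$ is a monic polynomial that is both $\mu$-minimal and $\mu$-irreducible; $\mathrm{KP}(\mu)$ is the set of them. If $\mathrm{KP}(\mu)\neq\emptyset$,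 the singular value is $\mathrm{sv}(\mu)=\mu(\phi)$ for any $\phi\in\mathrm{KP}(\mu)$ of minimal degree (independent of $\phi$). Trees. Let $\Lambda=\mathbb R^{\mathbb I}_{\mathrm{lex}}$ and let $\mathcal T$ be the set of all valuations $\mu\colon K[x]\to\Lambda\infty$ with $\mu_{|K}=v$, ordered by $\mu\le\nu\iff\mu(f)\le\nu(f)$ for all $f$. Leaves are the maximal elements (equivalently $\mathrm{KP}(\mu)=\emptyset$); the other elements are inner nodes. Let $\mathcal T^0=\{\rho\in\mathcal T\mid\Gamma_\rho\subset\mathbb R^{I_S}_{\mathrm{lex}}\text{ for some }S\in\mathrm{Init}(I)\}$. Let $\mathcal T_{\mathrm{sme}}\subset\mathcal T^0$ be the subset formed by all leaves of $\mathcal T^0$ and all inner nodes $\mu\in\mathcal T^0$ such that $\mathrm{sv}(\mu)\in\Gamma_{\mathrm{sme}}$. Finally, $\mathcal T_v$ is the set of equivalence classes of valuations on $K[x]$ (with arbitrary value group) whose restriction to $K$ is equivalent to $v$. *)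

(* Defs.v *)
From HB Require Import structures.
From mathcomp Require Import all_boot all_order all_algebra ring.
From mathcomp Require Import ring_quotient generic_quotient.
From mathcomp Require Import all_classical reals wochoice.
From mathcomp Require Import finmap monalg.

Set Implicit Arguments.
Unset Strict Implicit.
Unset Printing Implicit Defensive.

Import Order.TTheory GRing.Theory Num.Theory.

Local Open Scope classical_set_scope.
Local Open Scope quotient_scope.
Local Open Scope ring_scope.

HB.mixin Record isOrderedZmodule G of Num.POrderedZmodule G := {
  oler_total : total (<=%R : rel G);
  oler_wD2l : forall z : G, {homo +%R z : x y / x <= y}
}.

#[short(type="orderedZmodType")]
HB.structure Definition OrderedZmodule :=
  {G of isOrderedZmodule G & Num.POrderedZmodule G}.

Section OrderedZmoduleTheory.
Variable G : orderedZmodType.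
Implicit Types x y z : G.

Lemma oltNge x y : (x < y) = ~~ (y <= x).
Proof. exact/comparable_ltNge/oler_total. Qed.

Lemma olerD2l z : {mono +%R z : x y / x <= y}.
Proof.
by move=> x y; apply/idP/idP=> [/(oler_wD2l (- z))|/oler_wD2l //]; rewrite !addKr.
Qed.

Lemma olerD2r z : {mono +%R^~ z : x y / x <= y}.
Proof. by move=> x y; rewrite !(addrC _ z) olerD2l. Qed.

Lemma olerD x y z t : x <= y -> z <= t -> x + z <= y + t.
Proof.
by move=> xy zt; apply: (@le_trans _ _ (y + z)); rewrite ?olerD2r ?olerD2l.
Qed.

Lemma oltrD2l z : {mono +%R z : x y / x < y}.
Proof. exact/leW_mono/olerD2l. Qed.

Lemma osubr_ge0 x y : (0 <= y - x) = (x <= y).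
Proof. by rewrite -(olerD2r x) add0r subrK. Qed.

Lemma olerMn x y n : x <= y -> x *+ n <= y *+ n.
Proof. by move=> xy; elim: n => [|n IH]; rewrite ?mulr0n // !mulrS olerD. Qed.

Lemma olerMn2r n x y : (x *+ n.+1 <= y *+ n.+1) = (x <= y).
Proof.
apply/idP/idP; last exact: olerMn.
apply: contraTT; rewrite -!oltNge => yx; elim: n => [|n IH]; first by rewrite !mulr1n.
rewrite !(mulrS _ n.+1); apply: (@lt_le_trans _ _ (y + x *+ n.+1)).
  by rewrite oltrD2l.
by rewrite olerD2r ltW.
Qed.

Lemma omulrIn n x y : (x *+ n.+1 == y *+ n.+1) = (x == y).
Proof. by rewrite !eq_le !olerMn2r. Qed.

End OrderedZmoduleTheory.

(* Between torsion-free divisible groups, additive maps are Q-linear, so no     *)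
(* separate clause for Q-linear order embeddings is needed.                     *)
Record ordEmb (G G' : orderedZmodType) := OrdEmb {
  emb_fun :> G -> G';
  emb_add : {morph emb_fun : x y / x + y};
  emb_le : {mono emb_fun : x y / x <= y}
}.

Section Subgroups.
Variable G : orderedZmodType.

Definition subgroup (X : set G) : Prop :=
  X 0 /\ forall x y, X x -> X y -> X (x - y).

Definition convex_subgroup (X : set G) : Prop :=
  subgroup X /\ forall x y z, X x -> X z -> x <= y <= z -> X y.

Definition gen_subgroup (X : set G) : set G := smallest subgroup X.

Definition convex_gen (X : set G) : set G := smallest convex_subgroup X.

Definition nonzero_principal (C : set G) : Prop :=
  C <> [set 0] /\ exists x, C = convex_gen [set x].

Record convexSubgroup := ConvexSubgroup {
  cs_set :> set G;
  cs_convex : convex_subgroup cs_set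
}.

Definition maximal_proper (D C : convexSubgroup) : Prop :=
  (D : set G) `<` C /\
  forall E : convexSubgroup, (E : set G) `<` C -> (D : set G) `<=` E -> E = D.

End Subgroups.

Definition ordered_iso (G G' : orderedZmodType) (X : set G) (Y : set G')
    (f : G -> G') : Prop :=
  [/\ set_bij X Y f,
      forall x y, X x -> X y -> f (x + y) = f x + f y &
      forall x y, X x -> X y -> (f x <= f y) = (x <= y)].

(* [None] is the element oo *)
Definition infty (G : orderedZmodType) : Type := option G.

Section Infty.
Variable G : orderedZmodType.
Implicit Types a b c : infty G.

HB.instance Definition _ := Choice.on (infty G).

Definition ile a b : bool :=
  if b is Some y then (if a is Some x then x <= y else false) else true.

Lemma ile_refl : reflexive ile. Proof. by case=> //= x. Qed.

Lemma ile_anti : antisymmetric ile.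
Proof. by case=> [x|] [y|] //= /le_anti->. Qed.

Lemma ile_trans : transitive ile.
Proof. by case=> [x|] [y|] [z|] //=; apply: le_trans. Qed.

Lemma ile_total : total ile.
Proof. by case=> [x|] [y|] //=; apply: oler_total. Qed.

HB.instance Definition _ :=
  Order.Le_isPOrder.Build ring_display (infty G) ile_refl ile_anti ile_trans.
HB.instance Definition _ :=
  Order.POrder_isTotal.Build ring_display (infty G) ile_total.

Definition iadd a b : infty G :=
  if a is Some x then (if b is Some y then Some (x + y) else None) else None.

Lemma iaddA : associative iadd.
Proof. by case=> [x|] [y|] [z|] //=; rewrite addrA. Qed.

Lemma iaddC : commutative iadd.
Proof. by case=> [x|] [y|] //=; rewrite addrC. Qed.

Lemma iadd0 : left_id (Some 0 : infty G) iadd.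
Proof. by case=> [x|] //=; rewrite add0r. Qed.

HB.instance Definition _ := GRing.isNmodule.Build (infty G) iaddA iaddC iadd0.

End Infty.

Record valuation (A : comNzRingType) (L : orderedZmodType) := Valuation {
  val_fun :> A -> infty L;
  val1 : val_fun 1 = 0;
  val0 : val_fun 0 = None;
  valM : forall a b, val_fun (a * b) = val_fun a + val_fun b;
  valD : forall a b, Num.min (val_fun a) (val_fun b) <= val_fun (a + b)
}.

Definition value_group (A : Type) (L : orderedZmodType) (mu : A -> infty L) : set L :=
  gen_subgroup [set g | exists a, mu a = Some g].

Definition vequiv (A : Type) (L L' : orderedZmodType)
    (mu : A -> infty L) (nu : A -> infty L') : Prop :=
  exists2 iota : L -> L',
    ordered_iso (value_group mu) (value_group nu) iota &
    forall a, nu a = omap iota (mu a).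

(* Valuations on A with an arbitrary value group *)
Record anyValuation (A : comNzRingType) := AnyValuation {
  av_group : orderedZmodType;
  av_val :> valuation A av_group
}.

Definition vclass (A : comNzRingType) (L : orderedZmodType) (mu : valuation A L) :
    anyValuation A -> Prop :=
  fun nu => vequiv mu nu.

(* G (x) Q as the localization of the Z-module G at the nonzero integers: the   *)
(* class of (g, n) is g (x) 1/(n+1).                                            *)
Section DivHull.
Variable G : orderedZmodType.
Implicit Types p q r : G * nat.

Definition dh_equiv p q : bool := p.1 *+ q.2.+1 == q.1 *+ p.2.+1.

Lemma dh_equivP : equiv_class_of dh_equiv.
Proof.
split=> [p|p q|q p r]; rewrite /dh_equiv.
- by [].
- by rewrite eq_sym.
move=> /eqP pq /eqP qr.
by rewrite -(omulrIn q.2) mulrnAC pq mulrnAC qr mulrnAC.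
Qed.

Canonical dh_equiv_canonical := EquivRelPack dh_equivP.
Canonical dh_encModRel := defaultEncModRel dh_equiv.

Definition divHull : Type := {eq_quot dh_equiv}.
HB.instance Definition _ : EqQuotient _ dh_equiv divHull := EqQuotient.on divHull.
HB.instance Definition _ := Choice.on divHull.

Definition dh_zero : divHull := \pi_divHull (0, 0%N).
Definition dh_addp p q : G * nat :=
  (p.1 *+ q.2.+1 + q.1 *+ p.2.+1, (p.2.+1 * q.2.+1).-1).
Definition dh_add (x y : divHull) : divHull := \pi_divHull (dh_addp (repr x) (repr y)).
Definition dh_opp (x : divHull) : divHull := \pi_divHull (- (repr x).1, (repr x).2).
Definition dh_lep p q : bool := p.1 *+ q.2.+1 <= q.1 *+ p.2.+1.
Definition dh_le (x y : divHull) : bool := dh_lep (repr x) (repr y).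

Lemma dh_piP p q : reflect (\pi_divHull p = \pi_divHull q) (dh_equiv p q).
Proof. by apply: (iffP idP) => [h|/eqP]; rewrite ?piE //; apply/eqP; rewrite piE. Qed.

Lemma dh_repr p : dh_equiv (repr (\pi_divHull p)) p.
Proof. by apply/dh_piP; rewrite reprK. Qed.

Lemma dh_addp2 p q : (dh_addp p q).2.+1 = (p.2.+1 * q.2.+1)%N.
Proof. exact: (@prednK (p.2.+1 * q.2.+1)). Qed.

Lemma dh_addE p q :
  dh_add (\pi_divHull p) (\pi_divHull q) = \pi_divHull (dh_addp p q).
Proof.
apply/dh_piP; have := dh_repr p; have := dh_repr q.
move: (repr _) (repr _) => p' q'; rewrite /dh_equiv !dh_addp2 => /eqP hb /eqP ha.
rewrite /= !mulrnDl -!mulrnA; apply/eqP; congr (_ + _).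
  have -> : (q'.2.+1 * (p.2.+1 * q.2.+1) = p.2.+1 * (q'.2.+1 * q.2.+1))%N by ring.
  by rewrite mulrnA ha -mulrnA; congr (_ *+ _); ring.
have -> : (p'.2.+1 * (p.2.+1 * q.2.+1) = q.2.+1 * (p'.2.+1 * p.2.+1))%N by ring.
by rewrite mulrnA hb -mulrnA; congr (_ *+ _); ring.
Qed.

Lemma dh_oppE p : dh_opp (\pi_divHull p) = \pi_divHull (- p.1, p.2).
Proof.
apply/dh_piP; have := dh_repr p; rewrite /dh_equiv /= => /eqP.
by rewrite !mulNrn => ->.
Qed.

Lemma dh_leE p q : dh_le (\pi_divHull p) (\pi_divHull q) = dh_lep p q.
Proof.
rewrite /dh_le; have := dh_repr p; have := dh_repr q.
move: (repr _) (repr _) => p' q'; rewrite /dh_equiv /dh_lep => /eqP hb /eqP ha.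
rewrite -(olerMn2r (p.2 + q.2 + p.2 * q.2)).
rewrite -[RHS](olerMn2r (p'.2 + q'.2 + p'.2 * q'.2)).
have e x y : ((x + y + x * y).+1 = x.+1 * y.+1)%N by ring.
rewrite !e -!mulrnA; congr (_ <= _).
  have -> : (q'.2.+1 * (p.2.+1 * q.2.+1) = p.2.+1 * (q'.2.+1 * q.2.+1))%N by ring.
  by rewrite mulrnA ha -mulrnA; congr (_ *+ _); ring.
have -> : (p'.2.+1 * (p.2.+1 * q.2.+1) = q.2.+1 * (p'.2.+1 * p.2.+1))%N by ring.
by rewrite mulrnA hb -mulrnA; congr (_ *+ _); ring.
Qed.

Lemma dh_ind (P : divHull -> Prop) : (forall p, P (\pi_divHull p)) -> forall x, P x.
Proof. by move=> h x; rewrite -[x]reprK. Qed.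

Lemma dh_addA : associative dh_add.
Proof.
elim/dh_ind=> p; elim/dh_ind=> q; elim/dh_ind=> r; rewrite !dh_addE.
apply/dh_piP; rewrite /dh_equiv !dh_addp2 !mulnA; apply/eqP; congr (_ *+ _).
rewrite /dh_addp -!/(dh_addp _ _).2 !dh_addp2 /= !mulrnDl -!mulrnA addrA.
by congr (_ *+ _ + _ *+ _ + _ *+ _); ring.
Qed.

Lemma dh_addC : commutative dh_add.
Proof.
elim/dh_ind=> p; elim/dh_ind=> q; rewrite !dh_addE.
by rewrite /dh_addp addrC mulnC.
Qed.

Lemma dh_add0 : left_id dh_zero dh_add.
Proof.
elim/dh_ind=> p; rewrite dh_addE; apply/dh_piP; rewrite /dh_equiv dh_addp2.
by rewrite mul1n /= mul0rn add0r mulr1n.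
Qed.

Lemma dh_addN : left_inverse dh_zero dh_opp dh_add.
Proof.
elim/dh_ind=> -[g n]; rewrite dh_oppE dh_addE /dh_addp /=; apply/dh_piP.
by rewrite /dh_equiv /= mulNrn addNr !mul0rn.
Qed.

HB.instance Definition _ :=
  GRing.isZmodule.Build divHull dh_addA dh_addC dh_add0 dh_addN.

Lemma dh_le_refl : reflexive dh_le.
Proof. by move=> x; rewrite /dh_le /dh_lep. Qed.

Lemma dh_le_anti : antisymmetric dh_le.
Proof.
elim/dh_ind=> p; elim/dh_ind=> q; rewrite !dh_leE => /le_anti h.
by apply/dh_piP; rewrite /dh_equiv h.
Qed.

Lemma dh_le_trans : transitive dh_le.
Proof.
elim/dh_ind=> q; elim/dh_ind=> p; elim/dh_ind=> r; rewrite !dh_leE /dh_lep => pq qr.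
rewrite -(olerMn2r q.2) mulrnAC (le_trans (olerMn _ pq)) // mulrnAC.
by rewrite [leRHS]mulrnAC olerMn.
Qed.

Lemma dh_le_total : total dh_le.
Proof. by move=> x y; apply: oler_total. Qed.

HB.instance Definition _ :=
  Order.Le_isPOrder.Build ring_display divHull dh_le_refl dh_le_anti dh_le_trans.

Lemma dh_le_add (z : divHull) : {homo +%R z : x y / x <= y}.
Proof.
elim/dh_ind: z => -[c k]; elim/dh_ind=> -[a m]; elim/dh_ind=> -[b n].
have addE p q : (\pi_divHull p + \pi_divHull q : divHull) = \pi_divHull (dh_addp p q) by exact: dh_addE.
rewrite !addE; change (dh_le (\pi_divHull (a, m)) (\pi_divHull (b, n)) ->
  dh_le (\pi_divHull (dh_addp (c, k) (a, m))) (\pi_divHull (dh_addp (c, k) (b, n)))).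
rewrite !dh_leE /dh_lep !dh_addp2 /= => h.
rewrite !mulrnDl -!mulrnA.
have -> : (m.+1 * (k.+1 * n.+1) = n.+1 * (k.+1 * m.+1))%N by ring.
rewrite olerD2l.
have -> : (k.+1 * (k.+1 * n.+1) = n.+1 * (k.+1 * k.+1))%N by ring.
have -> : (k.+1 * (k.+1 * m.+1) = m.+1 * (k.+1 * k.+1))%N by ring.
by rewrite mulrnA [leRHS]mulrnA olerMn.
Qed.

HB.instance Definition _ := isOrderedZmodule.Build divHull dh_le_total dh_le_add.

Definition to_divHull_fun (g : G) : divHull := \pi_divHull (g, 0%N).

Lemma to_divHull_add : {morph to_divHull_fun : x y / x + y}.
Proof.
move=> x y; rewrite [RHS]dh_addE; apply/dh_piP.
by rewrite /dh_equiv dh_addp2 /= !mulr1n.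
Qed.

Lemma to_divHull_le : {mono to_divHull_fun : x y / x <= y}.
Proof. by move=> x y; rewrite [LHS]dh_leE /dh_lep /= !mulr1n. Qed.

Definition to_divHull : ordEmb G divHull := OrdEmb to_divHull_add to_divHull_le.

End DivHull.

(* The ordered group C / D, for convex subgroups D of C *)
Section ConvexQuotient.
Variables (G : orderedZmodType) (C D : convexSubgroup G).

Lemma csP (X : convexSubgroup G) : subgroup X.
Proof. by case: (cs_convex X). Qed.

Lemma cs_interval (X : convexSubgroup G) x y :
  (X : set G) y -> 0 <= x -> x <= y -> (X : set G) x.
Proof.
case: (cs_convex X) => -[X0 _] h Xy x0 xy; apply: (h 0 x y) => //.
by rewrite x0 xy.
Qed.

Definition cs_pred : pred G := fun x => x \in (C : set G).

Lemma cs_pred_zmod : zmod_closed cs_pred.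
Proof.
case: (csP C) => C0 CB; split; first exact/mem_set.
by move=> x y /set_mem Cx /set_mem Cy; apply/mem_set/CB.
Qed.
HB.instance Definition _ := GRing.isZmodClosed.Build G cs_pred cs_pred_zmod.

Record cs_type := CsElem { cs_val : G; cs_valP : cs_pred cs_val }.
HB.instance Definition _ := [isSub for cs_val].
HB.instance Definition _ := [Choice of cs_type by <:].
HB.instance Definition _ := [SubChoice_isSubZmodule of cs_type by <:].

Lemma cs_valD x y : cs_val (x + y) = cs_val x + cs_val y.
Proof. exact: (raddfD \val). Qed.

Definition cq_ker : pred cs_type := fun u => cs_val u \in (D : set G).

Lemma cq_ker_zmod : zmod_closed cq_ker.
Proof.
case: (csP D) => D0 DB; split; first exact/mem_set.
by move=> x y /set_mem Dx /set_mem Dy; apply/mem_set/DB.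
Qed.
HB.instance Definition _ := GRing.isZmodClosed.Build cs_type cq_ker cq_ker_zmod.

Definition cquot : Type := Quotient.quot (GRing.ZmodClosed.clone cs_type cq_ker _).
HB.instance Definition _ := GRing.Zmodule.on cquot.
HB.instance Definition _ := EqQuotient.on cquot.

(* By convexity of D the order does not depend on the representatives: see     *)
(* [cq_leE].                                                                   *)
Definition cq_le (a b : cquot) : bool := cs_val (repr a) <= cs_val (repr b).

Lemma cq_piP (u w : cs_type) :
  reflect (\pi_cquot u = \pi_cquot w) (cs_val u - cs_val w \in (D : set G)).
Proof.
apply: (iffP idP) => h.
  by apply/eqP; rewrite -Quotient.idealrBE.
by move/eqP: h; rewrite -Quotient.idealrBE.
Qed.

Lemma cq_leE (u w : cs_type) : cq_le (\pi_cquot u) (\pi_cquot w) =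
  (cs_val u <= cs_val w) || (cs_val u - cs_val w \in (D : set G)).
Proof.
case: (csP D) => D0 DB.
have DD x y : (D : set G) x -> (D : set G) y -> (D : set G) (x + y).
  by move=> Dx Dy; rewrite -[y]opprK -[- y]sub0r; apply: (DB) => //; apply: DB.
have DN x y : (D : set G) (x - y) -> (D : set G) (y - x).
  by move=> Dx; rewrite -opprB -sub0r; apply: DB.
have h (x : cs_type) : (D : set G) (cs_val (repr (\pi_cquot x)) - cs_val x).
  by apply/set_mem/cq_piP; rewrite reprK.
have key (a b a' b' : G) : (D : set G) (a' - a) -> (D : set G) (b' - b) ->
    a <= b -> b' <= a' -> (D : set G) (a' - b').
  move=> ha hb ab ba'; apply: (@cs_interval D _ ((a' - a) + (b - b'))).
  - by apply: DD => //; apply: DN.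
  - by rewrite osubr_ge0.
  rewrite -osubr_ge0 opprB -addrA subrKA addrC subrKA.
  by rewrite osubr_ge0.
rewrite /cq_le; apply/idP/idP => [le'|/orP[le|/cq_piP->//]].
  have [//|] := boolP (cs_val u <= cs_val w); rewrite -oltNge => /ltW le /=.
  by apply/mem_set/(key _ _ _ _ _ _ le' le); apply: DN.
have [//|] := boolP (cs_val _ <= cs_val _); rewrite -oltNge => lt.
have /mem_set/cq_piP := key _ _ _ _ (h u) (h w) le (ltW lt).
by rewrite !reprK => e; rewrite e ltxx in lt.
Qed.

Lemma cq_le_refl : reflexive cq_le.
Proof. by move=> a; apply: lexx. Qed.

Lemma cq_le_anti : antisymmetric cq_le.
Proof.
move=> a b /le_anti e; rewrite -[a]reprK -[b]reprK.
by apply/cq_piP; rewrite e subrr; apply/mem_set; case: (csP D).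
Qed.

Lemma cq_le_trans : transitive cq_le.
Proof. by move=> b a c; apply: le_trans. Qed.

Lemma cq_le_total : total cq_le.
Proof. by move=> a b; apply: oler_total. Qed.

HB.instance Definition _ :=
  Order.Le_isPOrder.Build ring_display cquot cq_le_refl cq_le_anti cq_le_trans.

Lemma cq_le_add (c : cquot) : {homo +%R c : a b / a <= b}.
Proof.
rewrite -[c]reprK => a b; rewrite -[a]reprK -[b]reprK.
have addE (x y : cs_type) : \pi_cquot x + \pi_cquot y = \pi_cquot (x + y).
  by rewrite -[RHS]/(\pi_(Quotient.quot (GRing.ZmodClosed.clone cs_type cq_ker _)) _) Quotient.pi_add.
rewrite !addE; move: (repr a) (repr b) (repr c) => x y z.
change (cq_le (\pi_cquot x) (\pi_cquot y) ->
        cq_le (\pi_cquot (z + x)) (\pi_cquot (z + y))).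
by rewrite !cq_leE !cs_valD olerD2l opprD addrACA subrr add0r.
Qed.

HB.instance Definition _ := isOrderedZmodule.Build cquot cq_le_total cq_le_add.

End ConvexQuotient.

(* An indexing of the nonzero principal convex subgroups [sk_sub i] of G by a   *)
(* totally ordered set, together with their maximal proper convex subgroups.    *)
Record skeleton (G : orderedZmodType) (d : Order.disp_t) (I : orderType d) :=
  Skeleton {
  sk_sub : I -> convexSubgroup G;
  sk_star : I -> convexSubgroup G;
  sk_bij : set_bij [set: I] (@nonzero_principal G) (fun i => sk_sub i : set G);
  sk_lt : forall i j, (i < j)%O <-> (sk_sub j : set G) `<` sk_sub i;
  sk_star_max : forall i, maximal_proper (sk_star i) (sk_sub i)
}.

Definition sk_quot (G : orderedZmodType) (d : Order.disp_t) (I : orderType d)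
    (s : skeleton G I) (i : I) : orderedZmodType :=
  cquot (sk_sub s i) (sk_star s i).

(* h induces C |-> (convex hull of h(C)) on nonzero principal convex subgroups, *)
(* and for each such C a map C / C^* -> C' / C'^* with C' the convex hull of    *)
(* h(C).                                                                        *)
Definition induces_skeleton_iso (G G' : orderedZmodType) (h : ordEmb G G') : Prop :=
  set_bij (@nonzero_principal G) (@nonzero_principal G')
    (fun C => convex_gen (h @` C)) /\
  forall (C D : convexSubgroup G) (C' D' : convexSubgroup G'),
    nonzero_principal C -> maximal_proper D C ->
    (C' : set G') = convex_gen (h @` C) -> maximal_proper D' C' ->
    (forall x, (C : set G) x -> ((D' : set G') (h x) <-> (D : set G) x)) /\
    (forall y, (C' : set G') y ->
       exists2 x, (C : set G) x & (D' : set G') (y - h x)).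

Lemma wo_chainP (d : Order.disp_t) (I : orderType d) (A : {pred I}) :
  wo_chain <=%O A <->
  forall B : set I, (forall x, B x -> x \in A) -> B !=set0 ->
    exists2 m, B m & forall x, B x -> (m <= x)%O.
Proof.
split=> [wo B BA [b Bb]|wo].
  have sB : {subset (mem B) <= A} by move=> x /set_mem /BA.
  have [|m [[/set_mem Bm hm] _]] := wo (mem B) sB; first by exists b; apply/mem_set.
  by exists m => // x Bx; apply/hm/mem_set.
apply: antisymmetric_wo_chain => [x y _ _|B BA [b Bb]]; first exact: le_anti.
have [||m Bm hm] := wo [set x | x \in B]; [by move=> x /BA|by exists b|].
by exists m; split.
Qed.

Lemma wo_chain_min (d : Order.disp_t) (I : orderType d) (A : {pred I}) (B : set I) :
  wo_chain <=%O A -> (forall x, B x -> x \in A) -> B !=set0 ->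
  exists2 m, B m & forall x, B x -> (m <= x)%O.
Proof. by move/wo_chainP; apply. Qed.

Section Hahn.
Variables (d : Order.disp_t) (I : orderType d) (Q : I -> orderedZmodType).

Record hahn := Hahn {
  hahn_fun :> forall i, Q i;
  hahn_wo : wo_chain <=%O [pred i | hahn_fun i != 0]
}.

Arguments hahn_wo : clear implicits.

HB.instance Definition _ := gen_eqMixin hahn.
HB.instance Definition _ := gen_choiceMixin hahn.

Implicit Types f g : hahn.

Lemma hahn_eq f g : (forall i, f i = g i) -> f = g.
Proof.
case: f g => f fP [g gP] /= fg.
have e : f = g by apply: functional_extensionality_dep.
by case: g / e gP {fg} => gP; congr Hahn; apply: Prop_irrelevance.
Qed.

Lemma wo_chain0 : wo_chain <=%O [pred i | (0 : Q i) != 0].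
Proof. by apply/wo_chainP => B h [b /h]; rewrite inE eqxx. Qed.

Lemma wo_chainN f : wo_chain <=%O [pred i | - f i != 0].
Proof.
apply/wo_chainP => B h B0; apply: (wo_chain_min (B := B) (hahn_wo f)) => //.
by move=> x /h; rewrite !inE oppr_eq0.
Qed.

Lemma wo_chainD f g : wo_chain <=%O [pred i | f i + g i != 0].
Proof.
apply/wo_chainP => B h [b0 Bb0].
pose BF := [set x | B x /\ f x != 0]; pose BG := [set x | B x /\ g x != 0].
have BU x : B x -> BF x \/ BG x.
  move=> Bx; have [f0|] := eqVneq (f x) 0; last by left.
  by right; split=> //; move: (h x Bx); rewrite inE f0 add0r.
have minF : BF !=set0 -> exists2 m, BF m & forall x, BF x -> (m <= x)%O.
  by apply: (wo_chain_min (hahn_wo f)) => x [].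
have minG : BG !=set0 -> exists2 m, BG m & forall x, BG x -> (m <= x)%O.
  by apply: (wo_chain_min (hahn_wo g)) => x [].
have [/minF [m [Bm _] hm]|nF] := pselect (BF !=set0); last first.
  have [|m [Bm _] hm] := minG; first by case: (BU _ Bb0) => hb; [case: nF|]; exists b0.
  exists m => // x /BU [] hx; last exact: hm.
  by case: nF; exists x.
have [/minG [m' [Bm' _] hm']|nG] := pselect (BG !=set0); last first.
  exists m => // x /BU [] hx; first exact: hm.
  by case: nG; exists x.
exists (Order.min m m'); first by rewrite minEle; case: ifP.
by move=> x /BU [/hm|/hm'] hx; rewrite ge_min hx // orbT.
Qed.

Arguments wo_chainN : clear implicits.
Arguments wo_chainD : clear implicits.

Definition hahn_zero : hahn := Hahn wo_chain0.
Definition hahn_opp f : hahn := Hahn (wo_chainN f).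
Definition hahn_add f g : hahn := Hahn (wo_chainD f g).

Lemma hahn_addA : associative hahn_add.
Proof. by move=> f g k; apply: hahn_eq => i /=; rewrite addrA. Qed.

Lemma hahn_addC : commutative hahn_add.
Proof. by move=> f g; apply: hahn_eq => i /=; rewrite addrC. Qed.

Lemma hahn_add0 : left_id hahn_zero hahn_add.
Proof. by move=> f; apply: hahn_eq => i /=; rewrite add0r. Qed.

Lemma hahn_addN : left_inverse hahn_zero hahn_opp hahn_add.
Proof. by move=> f; apply: hahn_eq => i /=; rewrite addNr. Qed.

HB.instance Definition _ :=
  GRing.isZmodule.Build hahn hahn_addA hahn_addC hahn_add0 hahn_addN.

Definition hahn_lt f g : Prop :=
  exists i, (forall j, (j < i)%O -> f j = g j) /\ f i < g i.

Definition hahn_le f g : bool := `[< f = g \/ hahn_lt f g >].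

Lemma hahn_lt_trans g f k : hahn_lt f g -> hahn_lt g k -> hahn_lt f k.
Proof.
move=> [i [fg ifg]] [j [gk jgk]]; case: (ltgtP i j) => ij.
- exists i; split; last by rewrite -gk.
  by move=> l li; rewrite fg // gk // (lt_trans li).
- exists j; split; last by rewrite fg.
  by move=> l lj; rewrite fg ?gk // (lt_trans lj).
- subst j; exists i; split; last exact: lt_trans jgk.
  by move=> l li; rewrite fg ?gk.
Qed.

Lemma hahn_lt_irr f : ~ hahn_lt f f.
Proof. by case=> i [_]; rewrite ltxx. Qed.

Lemma hahn_le_refl : reflexive hahn_le.
Proof. by move=> f; apply/asboolP; left. Qed.

Lemma hahn_le_anti : antisymmetric hahn_le.
Proof.
move=> f g /andP[/asboolP[//|fg] /asboolP[//|gf]].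
by case: (hahn_lt_irr (hahn_lt_trans fg gf)).
Qed.

Lemma hahn_le_trans : transitive hahn_le.
Proof.
move=> g f k /asboolP[->//|fg] /asboolP[<-|gk]; apply/asboolP; right => //.
exact: hahn_lt_trans gk.
Qed.

Lemma hahn_le_total : total hahn_le.
Proof.
move=> f g; have [->|/eqP fg] := eqVneq f g; first by rewrite hahn_le_refl.
have [i /eqP fi] : exists i, f i <> g i.
  by apply: contrapT => h; apply: fg; apply: hahn_eq => i; apply: contrapT => fi;
    apply: h; exists i.
have [||m /eqP fm hm] :=
    wo_chain_min (B := [set i | f i <> g i]) (hahn_wo (hahn_add f (hahn_opp g))).
- by move=> x /eqP; rewrite !inE subr_eq0.
- by exists i; apply/eqP.
have eqm j : (j < m)%O -> f j = g j.
  by move=> jm; apply: contrapT => /hm; rewrite leNgt jm.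
have [lt|] := boolP (f m < g m).
  by apply/orP; left; apply/asboolP; right; exists m.
rewrite oltNge negbK => le; apply/orP; right; apply/asboolP; right; exists m.
by split=> [j /eqm->//|]; rewrite lt_neqAle eq_sym fm.
Qed.

HB.instance Definition _ := Order.Le_isPOrder.Build ring_display hahn
  hahn_le_refl hahn_le_anti hahn_le_trans.

Lemma hahn_le_add (k : hahn) : {homo +%R k : f g / f <= g}.
Proof.
move=> f g /asboolP[->//|[i [fg lt]]]; apply/asboolP; right; exists i.
by split=> [j /fg /= ->//|/=]; rewrite oltrD2l.
Qed.

HB.instance Definition _ := isOrderedZmodule.Build hahn hahn_le_total hahn_le_add.

End Hahn.

Arguments hahn_wo {d I Q} h.

Definition realgrp (R : realType) : Type := R.

Section RealGroup.
Variable R : realType.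

HB.instance Definition _ := Num.POrderedZmodule.copy (realgrp R) R.

Lemma realgrp_total : total (<=%R : rel (realgrp R)).
Proof. exact: (@le_total _ R). Qed.

Lemma realgrp_add (z : realgrp R) : {homo +%R z : x y / x <= y}.
Proof. by move=> x y xy; rewrite (@lerD2l R). Qed.

HB.instance Definition _ :=
  isOrderedZmodule.Build (realgrp R) realgrp_total realgrp_add.

End RealGroup.

Section HahnMap.
Variables (d : Order.disp_t) (I : orderType d) (Q Q' : I -> orderedZmodType).
Variable e : forall i, ordEmb (Q i) (Q' i).

Lemma hahn_map_wo (f : hahn Q) : wo_chain <=%O [pred i | e i (f i) != 0].
Proof.
apply/wo_chainP => B h B0; apply: (wo_chain_min (B := B) (hahn_wo f)) => //.
move=> x /h; rewrite !inE; apply: contraNneq => ->.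
by rewrite -(addrK (e x 0) (e x 0)) -emb_add addr0 subrr.
Qed.

Arguments hahn_map_wo : clear implicits.

Definition hahn_map (f : hahn Q) : hahn Q' := Hahn (hahn_map_wo f).

End HahnMap.

Section BigIndex.
Variables (d : Order.disp_t) (I : orderType d).

Record initSeg := InitSeg {
  is_set :> set I;
  is_down : forall i j, is_set j -> (i <= j)%O -> is_set i
}.

(* [Cut S] is the formal symbol i_S *)
Inductive bigI := Elt of I | Cut of initSeg.

HB.instance Definition _ := gen_eqMixin bigI.
HB.instance Definition _ := gen_choiceMixin bigI.

Definition bigI_le (x y : bigI) : bool :=
  match x, y with
  | Elt i, Elt j => (i <= j)%O
  | Elt i, Cut s => `[< (s : set I) i >]
  | Cut s, Elt i => `[< ~ (s : set I) i >]
  | Cut s, Cut t => `[< (s : set I) `<=` t >]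
  end.

Lemma bigI_le_refl : reflexive bigI_le.
Proof. by case=> [i|S] /=; [apply: lexx|apply/asboolP]. Qed.

Lemma bigI_le_anti : antisymmetric bigI_le.
Proof.
case=> [i|S] [j|T] /= /andP[].
- by move=> ij ji; congr Elt; apply: le_anti; rewrite ij.
- by move=> /asboolP h /asboolP.
- by move=> /asboolP h /asboolP.
- move=> /asboolP ST /asboolP TS; congr Cut.
  case: S T ST TS => S hS [T hT] /= ST TS.
  have e : S = T by apply/seteqP.
  by case: T / e hT {ST TS} => hT; congr InitSeg; apply: Prop_irrelevance.
Qed.

Lemma bigI_le_trans : transitive bigI_le.
Proof.
case=> [j|T] [i|S] [k|U] //=.
- exact: le_trans.
- by move=> ij /asboolP Uj; apply/asboolP/(is_down Uj).
- move=> /asboolP Sj jk; apply/asboolP => Sk; apply: Sj; exact: is_down jk.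
- move=> /asboolP Sj /asboolP Uj; apply/asboolP => x Sx.
  case: (leP x j) => [xj|/ltW jx]; first exact: is_down xj.
  by case: Sj; apply: is_down jx.
- move=> /asboolP Ti /asboolP Tk; rewrite leNgt; apply/negP => /ltW ki.
  by apply: Tk; apply: is_down ki.
- by move=> /asboolP Ti /asboolP TU; apply/asboolP/TU.
- by move=> /asboolP ST /asboolP Tk; apply/asboolP => /ST.
- by move=> /asboolP ST /asboolP TU; apply/asboolP => x /ST /TU.
Qed.

Lemma bigI_le_total : total bigI_le.
Proof.
case=> [i|S] [j|T] /=; first exact: le_total.
- by case: (pselect ((T : set I) i)) => h; apply/orP; [left|right]; apply/asboolP.
- by case: (pselect ((S : set I) j)) => h; apply/orP; [right|left]; apply/asboolP.
case: (pselect ((S : set I) `<=` T)) => ST; first by rewrite asboolT.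
apply/orP; right; apply/asboolP => y Ty; apply: contrapT => Sy; apply: ST => x Sx.
case: (leP x y) => [xy|/ltW yx]; first exact: is_down xy.
by case: Sy; apply: is_down yx.
Qed.

HB.instance Definition _ :=
  Order.Le_isPOrder.Build d bigI bigI_le_refl bigI_le_anti bigI_le_trans.
HB.instance Definition _ := Order.POrder_isTotal.Build d bigI bigI_le_total.

Definition bigI_on (S : initSeg) : set bigI :=
  [set x | match x with Elt _ => True | Cut T => T = S end].

Variable V : orderedZmodType.

Definition ext0_fun (f : hahn (fun _ : I => V)) (x : bigI) : V :=
  if x is Elt i then f i else 0.

Lemma ext0_wo f : wo_chain <=%O [pred x | ext0_fun f x != 0].
Proof.
apply/wo_chainP => B h [b Bb].
have BE x : B x -> exists2 i, x = Elt i & f i != 0.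
  by move=> /h; rewrite inE; case: x => [i fi|S] /=; [exists i|rewrite eqxx].
have [||m Bm hm] := wo_chain_min (B := [set i | B (Elt i)]) (hahn_wo f).
- by move=> i /= /BE [_ [<-]].
- by have [i e _] := BE _ Bb; exists i; rewrite /= -e.
by exists (Elt m) => // x Bx; have [i e _] := BE _ Bx; subst x; apply: hm.
Qed.

Arguments ext0_wo : clear implicits.

Definition ext0 (f : hahn (fun _ : I => V)) : hahn (fun _ : bigI => V) :=
  Hahn (ext0_wo f).

(* The image of the Hahn product over I_S under extension by zero *)
Definition hahn_on (S : initSeg) : set (hahn (fun _ : bigI => V)) :=
  [set f | forall x, f x != 0 -> bigI_on S x].

Definition small_ext_reals : set (hahn (fun _ : bigI => V)) :=
  \bigcup_S hahn_on S.

End BigIndex.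

Definition sme_equiv (L : orderedZmodType) (Gam : set L) (b c : L) : Prop :=
  exists2 iota : L -> L,
    ordered_iso (gen_subgroup (Gam `|` [set b])) (gen_subgroup (Gam `|` [set c]))
      iota &
    (forall g, Gam g -> iota g = g) /\ iota b = c.

Definition sme_representatives (L : orderedZmodType) (Gam Rsme X : set L) : Prop :=
  X `<=` Rsme /\ forall b, Rsme b -> exists! c, X c /\ sme_equiv Gam b c.

(* The group algebra A[L] of an abelian group L: [monalg] only provides the     *)
(* multiplication for monoids without nontrivial units.                         *)
Definition grpalg (A : comNzRingType) (L : orderedZmodType) : Type := {malg A[L]}.

Section GroupAlgebra.
Variables (A : comNzRingType) (L : orderedZmodType).
Local Notation grpalg := (grpalg A L).
Implicit Types f g h : grpalg.

HB.instance Definition _ := GRing.Zmodule.on grpalg.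

Definition ga_mul f g : grpalg :=
  \sum_(k <- msupp f) \sum_(l <- msupp g) << f@_k * g@_l *g k + l >>.

Lemma ga_mulw (df dg : {fset L}) f g :
  (msupp f `<=` df)%fset -> (msupp g `<=` dg)%fset ->
  ga_mul f g = \sum_(k <- df) \sum_(l <- dg) << f@_k * g@_l *g k + l >>.
Proof.
move=> fd gd; rewrite /ga_mul (big_fset_incl _ fd) /=.
  apply: eq_bigr => k _; apply: big_fset_incl => // l _ /mcoeff_outdom ->.
  by rewrite mulr0 monalgU0.
move=> k _ /mcoeff_outdom fk.
by rewrite big1 // => l _; rewrite fk mul0r monalgU0.
Qed.

Lemma ga_mulC : commutative ga_mul.
Proof.
move=> f g; rewrite /ga_mul exchange_big /=.
by apply: eq_bigr => k _; apply: eq_bigr => l _; rewrite mulrC addrC.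
Qed.

Lemma ga_mulDl : left_distributive ga_mul +%R.
Proof.
move=> f g h; rewrite (ga_mulw (msuppD_le _ _) (fsubset_refl _)).
rewrite (ga_mulw (fsubsetUl _ (msupp g)) (fsubset_refl _)).
rewrite (ga_mulw (fsubsetUr (msupp f) _) (fsubset_refl _)).
rewrite -big_split /=; apply: eq_bigr => k _.
rewrite -big_split /=; apply: eq_bigr => l _.
by rewrite mcoeffD mulrDl monalgUD.
Qed.

Lemma ga_mul0 f : ga_mul 0 f = 0.
Proof. by rewrite /ga_mul msupp0 big_seq_fset0. Qed.

Lemma ga_mulUU (a b : A) (k l : L) :
  ga_mul << a *g k >> << b *g l >> = << a * b *g k + l >>.
Proof.
by rewrite (ga_mulw msuppU_le msuppU_le) !big_seq_fset1 !mcoeffUU.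
Qed.

Lemma ga_ind (P : grpalg -> Prop) :
  P 0 -> (forall f g, P f -> P g -> P (f + g)) ->
  (forall a k, P << a *g k >>) -> forall f, P f.
Proof.
move=> P0 PD PU f; rewrite [f]monalgE.
by elim/big_ind: _ => // k _.
Qed.

Lemma ga_mulA : associative ga_mul.
Proof.
have DR f g h : ga_mul f (g + h) = ga_mul f g + ga_mul f h.
  by rewrite !(ga_mulC f) ga_mulDl.
have R0 f : ga_mul f 0 = 0 by rewrite ga_mulC ga_mul0.
elim/ga_ind=> [|f f' IH IH'|a k] g h; first by rewrite !ga_mul0.
  by rewrite !ga_mulDl IH IH'.
elim/ga_ind: g h => [|g g' IH IH'|b l] h; first by rewrite !(ga_mul0, R0).
  by rewrite !(DR, ga_mulDl) IH IH'.
elim/ga_ind: h => [|h h' IH IH'|c m]; first by rewrite !R0.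
  by rewrite !DR IH IH'.
by rewrite !ga_mulUU mulrA addrA.
Qed.

Definition ga_one : grpalg := << 1 *g 0 >>.

Lemma ga_mul1 : left_id ga_one ga_mul.
Proof.
elim/ga_ind=> [|f g IH IH'|a k]; first by rewrite ga_mulC ga_mul0.
  by rewrite ga_mulC ga_mulDl !(ga_mulC _ ga_one) IH IH'.
by rewrite ga_mulUU mul1r add0r.
Qed.

Lemma ga_one_neq0 : ga_one != 0.
Proof. by rewrite monalgU_eq0 oner_eq0. Qed.

HB.instance Definition _ := GRing.Zmodule_isComNzRing.Build grpalg
  ga_mulA ga_mulC ga_mul1 ga_mulDl ga_one_neq0.

Lemma ga_coefM f g (x : L) : (f * g : grpalg)@_x =
  \sum_(k <- msupp f) \sum_(l <- msupp g) (f@_k * g@_l) *+ (k + l == x).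
Proof.
rewrite [f * g]/(ga_mul f g) raddf_sum /=; apply: eq_bigr => k _.
by rewrite raddf_sum /=; apply: eq_bigr => l _; rewrite mcoeffU.
Qed.

End GroupAlgebra.

(* The graded algebra of mu, as (\bigoplus_a P_a) / (\bigoplus_a P_a^+): the    *)
(* first sum is the subring [gr_sub] of the group algebra, with a in the value  *)
(* group of mu, and the second is its ideal [gr_ideal].                         *)
Section GradedAlgebra.
Variables (A : comNzRingType) (L : orderedZmodType) (mu : valuation A L).

Lemma ile_add (x y : infty L) (a b : L) : (Some a : infty L) <= x ->
  (Some b : infty L) <= y -> (Some (a + b) : infty L) <= x + y.
Proof. by case: x y => [x|] [y|] //; apply: olerD. Qed.

Lemma ilt_add (x y : infty L) (a b : L) : (Some a : infty L) <= x ->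
  (Some b : infty L) < y -> (Some (a + b) : infty L) < x + y.
Proof.
case: x y => [x|] [y|] // ax; rewrite !lt_neqAle => /andP[nby lby].
have ltby : b < y by rewrite lt_neqAle (lby : b <= y) andbT; apply: contraNneq nby => ->.
have lt : a + b < x + y.
  by apply: (@lt_le_trans _ _ (a + y)); rewrite ?oltrD2l ?olerD2r.
apply/andP; split; last exact: ltW lt.
by apply/eqP => -[e]; rewrite e ltxx in lt.
Qed.

Lemma val_ge_sum (I : Type) (r : seq I) (F : I -> A) (a : L) :
  (forall i, (Some a : infty L) <= mu (F i)) ->
  (Some a : infty L) <= mu (\sum_(i <- r) F i).
Proof.
move=> h; elim/big_ind: _ => [|x y hx hy|//]; first by rewrite val0.
by apply: le_trans (valD mu x y); rewrite le_min hx hy.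
Qed.

Lemma val_gt_sum (I : Type) (r : seq I) (F : I -> A) (a : L) :
  (forall i, (Some a : infty L) < mu (F i)) ->
  (Some a : infty L) < mu (\sum_(i <- r) F i).
Proof.
move=> h; elim/big_ind: _ => [|x y hx hy|//]; first by rewrite val0.
by apply: lt_le_trans (valD mu x y); rewrite lt_min hx hy.
Qed.

Lemma value_group_subgroup : subgroup (value_group mu).
Proof.
split=> [X [[]] //|x y hx hy X hX]; case: (hX) => -[_ XB] _.
by apply: XB; [apply: hx|apply: hy].
Qed.

Lemma valN1 : mu (-1) = 0.
Proof.
have := valM mu (-1) (-1); rewrite mulrNN mulr1 val1.
case: (mu (-1)) => [x|] //= [e]; congr Some.
apply/eqP; rewrite -(omulrIn 1) mul0rn mulr2n; apply/eqP.
by rewrite -e.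
Qed.

Lemma valN g : mu (- g) = mu g.
Proof. by rewrite -mulN1r valM valN1 add0r. Qed.

Definition gr_sub : pred (grpalg A L) := fun F => `[< forall a,
  (F@_a != 0 -> value_group mu a) /\ (Some a : infty L) <= mu F@_a >].

Lemma gr_sub_subring : subring_closed gr_sub.
Proof.
have [G0 GB] := value_group_subgroup.
have GD x y : value_group mu x -> value_group mu y -> value_group mu (x + y).
  by move=> hx hy; rewrite -[y]opprK -[- y]sub0r; apply: (GB) => //; apply: GB.
split=> [|F H /asboolP hF /asboolP hH|F H /asboolP hF /asboolP hH].
- apply/asboolP => a; rewrite /1 /= mcoeffU; case: (eqVneq 0 a) => [<-|_].
    by rewrite mulr1n val1.
  by rewrite mulr0n eqxx val0.
- apply/asboolP => a; rewrite mcoeffB; have [gF vF] := hF a; have [gH vH] := hH a.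
  split; last by apply: le_trans (valD mu _ _); rewrite le_min vF valN.
  have [F0|/gF //] := eqVneq F@_a 0; rewrite F0 sub0r oppr_eq0; exact: gH.
- apply/asboolP => a; rewrite ga_coefM; split; last first.
    apply: val_ge_sum => k; apply: val_ge_sum => l.
    case: (eqVneq (k + l) a) => [<-|_]; last by rewrite mulr0n val0.
    by rewrite mulr1n valM; apply: ile_add; [case: (hF k)|case: (hH l)].
  move=> /eqP h; apply: contrapT => na; apply: h.
  rewrite big1 // => k _; rewrite big1 // => l _.
  case: (eqVneq (k + l) a) => [e|_]; rewrite ?mulr0n ?mulr1n //.
  have [->|/(hF k).1 hk] := eqVneq F@_k 0; first by rewrite mul0r.
  have [->|/(hH l).1 hl] := eqVneq H@_l 0; first by rewrite mulr0.
  by case: na; rewrite -e; apply: GD.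
Qed.

HB.instance Definition _ :=
  GRing.isSubringClosed.Build (grpalg A L) gr_sub gr_sub_subring.

Record gr_elt := GrElt { gr_val : grpalg A L; gr_valP : gr_sub gr_val }.
HB.instance Definition _ := [isSub for gr_val].
HB.instance Definition _ := [Choice of gr_elt by <:].
HB.instance Definition _ := [SubChoice_isSubComNzRing of gr_elt by <:].

Definition gr_ideal : pred gr_elt :=
  fun u => `[< forall a, (Some a : infty L) < mu (gr_val u)@_a >].

Lemma gr_ideal_closed : idealr_closed gr_ideal.
Proof.
have v0 (a : L) : (Some a : infty L) < mu 0 by rewrite val0.
split.
- by apply/asboolP => a; rewrite [gr_val 0](raddf0 \val) mcoeff0.
- apply/asboolP => /(_ 0); rewrite [gr_val 1](rmorph1 \val).
  by rewrite /1 /= mcoeffUU val1 ltxx.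
- move=> F u w /asboolP hu /asboolP hw; apply/asboolP => a.
  have vD (x y : gr_elt) : gr_val (x + y) = gr_val x + gr_val y.
    exact: (raddfD \val).
  have vM (x y : gr_elt) : gr_val (x * y) = gr_val x * gr_val y.
    exact: (rmorphM \val).
  rewrite vD vM mcoeffD.
  apply: lt_le_trans (valD mu _ _); rewrite lt_min hw andbT.
  rewrite ga_coefM.
  apply: val_gt_sum => k; apply: val_gt_sum => l.
  case: (eqVneq (k + l) a) => [<-|_]; last by rewrite mulr0n v0.
  rewrite mulr1n valM; apply: ilt_add => //.
  by have /asboolP/(_ k) [] := gr_valP F.
Qed.

HB.instance Definition _ := isIdealr.Build gr_elt gr_ideal gr_ideal_closed.

Definition graded : Type := Quotient.quot (Idealr.clone gr_elt gr_ideal _).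
HB.instance Definition _ := GRing.ComNzRing.on graded.
HB.instance Definition _ := EqQuotient.on graded.

Lemma gr_monom_subproof (g : A) (a : L) : mu g = Some a -> gr_sub << g *g a >>.
Proof.
move=> ga; apply/asboolP => b; rewrite mcoeffU; case: (eqVneq a b) => [<-|_].
  by rewrite mulr1n ga; split=> // _ X [_]; apply; exists g.
by rewrite mulr0n eqxx val0.
Qed.

(* The class of g in degree mu g, and 0 for g in the support of mu *)
Definition initial (g : A) : graded :=
  match mu g as x return mu g = x -> graded with
  | Some a => fun ga => \pi_graded (GrElt (gr_monom_subproof ga))
  | None => fun _ => 0
  end erefl.

Definition val_dvd (h g : A) : Prop :=
  exists z : graded, initial g = initial h * z.

Definition val_irreducible (g : A) : Prop :=
  let I : pred graded := fun y => `[< exists z, y = initial g * z >] in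
  [/\ initial g != 0, idealr_closed I & prime_idealr_closed I].

End GradedAlgebra.

Section KeyPolynomials.
Variables (K : fieldType) (L : orderedZmodType) (mu : valuation {poly K} L).

Definition val_minimal (g : {poly K}) : Prop :=
  forall f : {poly K}, f != 0 -> (size f < size g)%N -> ~ val_dvd mu g f.

Definition key_poly (g : {poly K}) : Prop :=
  [/\ g \is monic, val_minimal g & val_irreducible mu g].

Definition singular_value : infty L :=
  xget None [set a : infty L | exists phi, [/\ key_poly phi,
    forall psi, key_poly psi -> (size phi <= size psi)%N & a = mu phi]].

End KeyPolynomials.

Definition vle (A : comNzRingType) (L : orderedZmodType) (mu nu : valuation A L) :
    Prop :=
  forall f, mu f <= nu f.

Definition leaf (A : comNzRingType) (L : orderedZmodType)
    (T : set (valuation A L)) (mu : valuation A L) : Prop :=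
  T mu /\ forall nu, T nu -> vle mu nu -> nu = mu.

Definition inner_node (A : comNzRingType) (L : orderedZmodType)
    (T : set (valuation A L)) (mu : valuation A L) : Prop :=
  T mu /\ ~ leaf T mu.

(* The set of valuations on K[x] extending v, where the value group G of v is   *)
(* identified with a subgroup of L through iota.                                *)
Definition tree (K : fieldType) (G L : orderedZmodType) (v : valuation K G)
    (iota : G -> L) : set (valuation {poly K} L) :=
  [set mu | forall a, mu a%:P = omap iota (v a)].

Definition tree0 (R : realType) (K : fieldType) (G : orderedZmodType)
    (d : Order.disp_t) (I : orderType d) (v : valuation K G)
    (iota : G -> hahn (fun _ : bigI I => realgrp R)) :
    set (valuation {poly K} (hahn (fun _ : bigI I => realgrp R))) :=
  [set mu | tree v iota mu /\ exists s : initSeg I, value_group mu `<=` hahn_on s].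

Definition tree_sme (R : realType) (K : fieldType) (G : orderedZmodType)
    (d : Order.disp_t) (I : orderType d) (v : valuation K G)
    (iota : G -> hahn (fun _ : bigI I => realgrp R))
    (Gsme : set (hahn (fun _ : bigI I => realgrp R))) :
    set (valuation {poly K} (hahn (fun _ : bigI I => realgrp R))) :=
  [set mu | leaf (tree0 v iota) mu \/
    (inner_node (tree0 v iota) mu /\
     exists2 g, singular_value mu = Some g & Gsme g)].

Definition tree_v (K : fieldType) (G : orderedZmodType) (v : valuation K G) :
    (anyValuation {poly K} -> Prop) -> Prop :=
  fun c => exists w : anyValuation {poly K},
    vequiv v (fun a => w a%:P) /\ c = vclass w.

(* [set_bij] cannot be used: the universe of [anyValuation] is too large for    *)
(* [set].                                                                       *)
Definition bijection_on (X Y : Type) (P : X -> Prop) (Q : Y -> Prop) (f : X -> Y) :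
    Prop :=
  [/\ forall x, P x -> Q (f x),
      forall x y, P x -> P y -> f x = f y -> x = y &
      forall y, Q y -> exists2 x, P x & f x = y].

(* G -> G (x) Q -> H(G (x) Q) -> R^I_lex -> R^bigI_lex *)
Definition real_embedding (R : realType) (G : orderedZmodType)
    (d : Order.disp_t) (I : orderType d) (s : skeleton (divHull G) I)
    (h : ordEmb (divHull G) (hahn (sk_quot s)))
    (e : forall i, ordEmb (sk_quot s i) (realgrp R)) (g : G) :
    hahn (fun _ : bigI I => realgrp R) :=
  ext0 (hahn_map e (h (to_divHull G g))).

(* Main.v *)
(* Let Gam be the value group of v inside L = R^bigI_lex. An extension mu of v to K[x]
   is either commensurable (all finite values are torsion over Gam) or there is a
   monic phi of minimal degree whose value gam is not torsion over Gam; then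
   mu (sum a_i phi^i) = min (mu a_i + i gam), so that Gam and gam determine the
   value group up to torsion. In the second case f |-> mu (f mod phi) is a strictly
   larger valuation, so mu is an inner node, and phi is a key polynomial, of minimal
   degree because polynomials of smaller degree have invertible initial terms; thus
   sv(mu) = gam.

   Injectivity: an equivalence of mu with nu fixes Gam, hence its torsion hull, and
   sends sv(mu) to sv(nu); these are sme-equivalent representatives, hence equal.

   Surjectivity: a commensurable value group embeds uniquely over Gam in the
   divisible group L. Otherwise gam defines a cut of the torsion hull of Gam, every
   cut of R^I_lex is filled by some element of R_sme, and that element can be
   replaced by its representative in Gamma_sme. *)
Require Import Defs.
From HB Require Import structures.
From mathcomp Require Import all_boot all_order all_algebra zify.
From mathcomp Require Import ring_quotient generic_quotient finmap monalg.
From mathcomp Require Import all_classical reals wochoice.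

Set Implicit Arguments.
Unset Strict Implicit.
Unset Printing Implicit Defensive.

Import Order.TTheory GRing.Theory Num.Theory.

Local Open Scope classical_set_scope.
Local Open Scope quotient_scope.
Local Open Scope ring_scope.

(** * Subgroups, equivalence of valuations *)


Section SubgroupTheory.
Variable L : orderedZmodType.
Implicit Types (X : set L) (x y : L).

Lemma subgroupN X x : subgroup X -> X x -> X (- x).
Proof. by move=> [X0 XB] Xx; rewrite -sub0r; apply: XB. Qed.

Lemma subgroupD X x y : subgroup X -> X x -> X y -> X (x + y).
Proof. by move=> sX Xx Xy; rewrite -[y]opprK; apply: sX.2 => //; apply: subgroupN. Qed.

Lemma subgroupMn X x n : subgroup X -> X x -> X (x *+ n).
Proof.
move=> sX Xx; elim: n => [|n IH]; first by rewrite mulr0n; apply: sX.1.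
by rewrite mulrS; apply: subgroupD.
Qed.

Lemma subgroupMz X x m : subgroup X -> X x -> X (x *~ m).
Proof.
move=> sX Xx; case: m => n; rewrite /intmul /=; first exact: subgroupMn.
by apply: subgroupN => //; apply: subgroupMn.
Qed.

Lemma gen_subgroup_subgroup X : subgroup (gen_subgroup X).
Proof.
split=> [Y [[]] //|x y hx hy Y hY]; case: (hY) => -[_ YB] _.
by apply: YB; [apply: hx|apply: hy].
Qed.

Lemma sub_gen_subgroup X : X `<=` gen_subgroup X.
Proof. by move=> x Xx Y [_]; apply. Qed.

Lemma gen_subgroup_sub X Y : subgroup Y -> X `<=` Y -> gen_subgroup X `<=` Y.
Proof. by move=> sY XY x; apply. Qed.

End SubgroupTheory.

Section AdditiveOn.
Variables (L L' : orderedZmodType) (X : set L) (f : L -> L').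
Hypothesis (sX : subgroup X).
Hypothesis (fD : forall x y, X x -> X y -> f (x + y) = f x + f y).

Lemma add_on0 : f 0 = 0.
Proof. by apply: (addrI (f 0)); rewrite -fD ?addr0 //; apply: sX.1. Qed.

Lemma add_onN x : X x -> f (- x) = - f x.
Proof.
move=> Xx; apply/eqP; rewrite -addr_eq0; apply/eqP; rewrite -fD //.
  by rewrite addNr add_on0.
exact: subgroupN.
Qed.

Lemma add_onMn x n : X x -> f (x *+ n) = f x *+ n.
Proof.
move=> Xx; elim: n => [|n IH]; first by rewrite !mulr0n add_on0.
by rewrite !mulrS fD ?IH //; apply: subgroupMn.
Qed.

Lemma add_onMz x m : X x -> f (x *~ m) = f x *~ m.
Proof.
move=> Xx; case: m => n; rewrite /intmul /=; first exact: add_onMn.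
by rewrite add_onN ?add_onMn //; apply: subgroupMn.
Qed.

Lemma preimage_subgroup (Y : set L') : subgroup Y ->
  subgroup [set x | X x /\ Y (f x)].
Proof.
move=> sY; split; first by split; [apply: sX.1|rewrite add_on0; apply: sY.1].
move=> x y [Xx Yx] [Xy Yy]; split; first exact: sX.2.
by rewrite fD ?add_onN //; [apply: sY.2|apply: subgroupN].
Qed.

(** The elements of [X] sent into the target form a subgroup containing [Z], which gives one
    inclusion. The other holds because the image of a subgroup is a subgroup. *)
Lemma gen_subgroup_image (Z : set L) : Z `<=` X ->
  f @` gen_subgroup Z = gen_subgroup (f @` Z).
Proof.
move=> ZX; apply/seteqP; split=> [_ [x Zx <-]|].
  have /(_ x Zx)[] // : gen_subgroup Z `<=` [set x | X x /\ gen_subgroup (f @` Z) (f x)].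
  apply: gen_subgroup_sub; first exact/preimage_subgroup/gen_subgroup_subgroup.
  move=> y Zy; split; first exact: ZX.
  by apply: sub_gen_subgroup; exists y.
apply: gen_subgroup_sub; last by move=> _ [x Zx <-]; exists x => //; apply: sub_gen_subgroup.
have [G0 GB] := gen_subgroup_subgroup Z.
have GX : gen_subgroup Z `<=` X by apply: gen_subgroup_sub.
split; first by exists 0 => //; apply: add_on0.
move=> _ _ [x Zx <-] [y Zy <-]; exists (x - y); first exact: GB.
by rewrite fD ?add_onN //; do ?[exact: GX | exact: (subgroupN sX (GX _ Zy))].
Qed.

Hypothesis (fle : forall x y, X x -> X y -> (f x <= f y) = (x <= y)).

Lemma mono_on_ordered_iso : ordered_iso X (f @` X) f.
Proof.
split=> //; split=> [x Xx|x y /set_mem Xx /set_mem Xy e|_ [x Xx <-]]; [by exists x| |by exists x].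
by apply/le_anti; rewrite -!fle // e lexx.
Qed.

End AdditiveOn.

Lemma ordered_iso_sub (L L' : orderedZmodType) (X Z : set L) (Y : set L') f :
  ordered_iso X Y f -> Z `<=` X -> ordered_iso Z (f @` Z) f.
Proof.
move=> [_ fD fle] ZX.
have fI : forall x y, Z x -> Z y -> f x = f y -> x = y.
  by move=> x y /ZX Zx /ZX Zy e; apply/le_anti; rewrite -!fle // e lexx.
split; last 2 first.
- by move=> x y /ZX Zx /ZX Zy; apply: fD.
- by move=> x y /ZX Zx /ZX Zy; apply: fle.
split=> [x Zx|x y /set_mem Zx /set_mem Zy|_ [x Zx <-]]; [by exists x|exact: fI|by exists x].
Qed.

Lemma ordered_iso_comp (L L' L'' : orderedZmodType) (X : set L) (Y : set L')
    (Z : set L'') f g :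
  ordered_iso X Y f -> ordered_iso Y Z g -> ordered_iso X Z (g \o f).
Proof.
move=> [[fXY fI fS] fD fle] [[gYZ gI gS] gD gle].
split=> [|x y Xx Xy|x y Xx Xy] /=; last 2 first.
- by rewrite fD ?gD //; apply: fXY.
- by rewrite gle ?fle //; apply: fXY.
split=> [x Xx|x y /set_mem Xx /set_mem Xy /= e|z /gS[y Yy <-]].
- exact/gYZ/fXY.
- apply: fI; rewrite ?inE //; apply: gI; rewrite ?inE //; exact: fXY.
- by have [x Xx <-] := fS _ Yy; exists x.
Qed.

Lemma ordered_iso_inv (L L' : orderedZmodType) (X : set L) (Y : set L') f :
  subgroup X -> ordered_iso X Y f ->
  exists2 g, ordered_iso Y X g & forall x, X x -> g (f x) = x.
Proof.
move=> sX [[fXY fI fS] fD fle].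
(* [ordered_iso] constrains [f] on [X] alone, so the inverse is chosen pointwise, with junk value 0
   off [Y]. *)
pose g y := xget 0 [set x | X x /\ f x = y].
have gP y : Y y -> X (g y) /\ f (g y) = y.
  by move=> /fS [x Xx <-]; apply: (@xgetPex _ 0 [set z | X z /\ f z = f x]); exists x.
have gK x : X x -> g (f x) = x.
  move=> Xx; have [Xg e] := gP _ (fXY _ Xx).
  by apply: fI; rewrite ?inE.
exists g => //; split=> [|x y /fS[x' Xx <-] /fS[y' Xy <-]|x y /fS[x' Xx <-] /fS[y' Xy <-]].
- split=> [y /gP[]//|x y /set_mem /gP[_ ex] /set_mem /gP[_ ey] e|x Xx].
    by rewrite -ex e.
  by exists (f x); [apply: fXY|apply: gK].
- by rewrite -fD // !gK //; apply: subgroupD.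
- by rewrite !gK // fle.
Qed.

Section Vequiv.
Variable A : Type.

Lemma vequiv_refl (L : orderedZmodType) (mu : A -> infty L) : vequiv mu mu.
Proof.
exists id => [|a]; last by case: (mu a).
by split=> //; split=> // x Xx; exists x.
Qed.

Lemma vequiv_sym (L L' : orderedZmodType) (mu : A -> infty L) (nu : A -> infty L') :
  vequiv mu nu -> vequiv nu mu.
Proof.
move=> [f fiso e]; have [g giso gK] := ordered_iso_inv (@gen_subgroup_subgroup _ _) fiso.
exists g => // a; rewrite e; case E: (mu a) => [x|] //=.
by rewrite gK //; apply: sub_gen_subgroup; exists a.
Qed.

Lemma vequiv_trans (L L' L'' : orderedZmodType) (mu : A -> infty L)
    (nu : A -> infty L') (rho : A -> infty L'') :
  vequiv mu nu -> vequiv nu rho -> vequiv mu rho.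
Proof.
move=> [f fiso ef] [g giso eg]; exists (g \o f); first exact: ordered_iso_comp giso.
by move=> a; rewrite eg ef; case: (mu a).
Qed.

(** Generating a subgroup commutes with taking images, so [f] maps onto the value group of [nu]. *)
Lemma vequiv_map (L L' : orderedZmodType) (mu : A -> infty L) (nu : A -> infty L')
    (f : L -> L') :
  (forall x y, value_group mu x -> value_group mu y -> f (x + y) = f x + f y) ->
  (forall x y, value_group mu x -> value_group mu y -> (f x <= f y) = (x <= y)) ->
  (forall a, nu a = omap f (mu a)) -> vequiv mu nu.
Proof.
move=> fD fle e; exists f => //.
suff -> : value_group nu = f @` value_group mu.
  exact: mono_on_ordered_iso.
rewrite (gen_subgroup_image (@gen_subgroup_subgroup _ _) fD); last exact: sub_gen_subgroup.
congr gen_subgroup; apply/seteqP; split=> [y [a]|_ [x [a ex] <-]].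
  by rewrite e; case E: (mu a) => [x|] //= [<-]; exists x => //; exists a.
by exists a; rewrite e ex.
Qed.

End Vequiv.

(** * Ultrametric rules and push-forward of valuations *)

Section ValuationTheory.
Variables (A : comNzRingType) (L : orderedZmodType).
Implicit Types (mu nu : valuation A L).

Lemma valuation_eq mu nu : (forall a, mu a = nu a) -> mu = nu.
Proof.
case: mu nu => f f1 f0 fM fD [g g1 g0 gM gD] /= /funext e.
by case: g / e g1 g0 gM gD => *; congr Valuation; apply: Prop_irrelevance.
Qed.

Lemma ileNone (x : infty L) : x <= (None : infty L).
Proof. by case: x. Qed.

Lemma ileSome (x y : L) : ((Some x : infty L) <= Some y) = (x <= y).
Proof. by []. Qed.

Lemma iaddSome (x y : L) : (Some x : infty L) + (Some y : infty L) = Some (x + y).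
Proof. by []. Qed.

Lemma val_valueP mu a x : mu a = Some x -> value_group mu x.
Proof. by move=> e; apply: sub_gen_subgroup; exists a. Qed.

Lemma val_addl mu a b : mu a < mu b -> mu (a + b) = mu a.
Proof.
move=> lt; apply/le_anti/andP; split; last first.
  by apply: le_trans (valD mu _ _); rewrite le_min lexx ltW.
rewrite leNgt; apply/negP => lt'.
have := valD mu (a + b) (- b); rewrite addrK valN leNgt.
by rewrite lt_min lt lt'.
Qed.

Lemma val_add_neq mu a b : mu a != mu b -> mu (a + b) = Num.min (mu a) (mu b).
Proof.
case: ltgtP => // lt _; first exact: val_addl.
by rewrite addrC; apply: val_addl.
Qed.

Lemma valB mu a b : Num.min (mu a) (mu b) <= mu (a - b).
Proof. by rewrite -(valN mu b); apply: valD. Qed.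

(** A class is a predicate; evaluating it at [nu] itself recovers the equivalence. *)
Lemma vequiv_vclass (L' : orderedZmodType) mu (nu : valuation A L') :
  vclass mu = vclass nu <-> vequiv mu nu.
Proof.
split=> [e|e]; last first.
  apply: funext => rho; apply: propext; split=> h.
    exact: vequiv_trans (vequiv_sym e) h.
  exact: vequiv_trans e h.
have : vclass nu (AnyValuation nu) by exact: vequiv_refl.
by rewrite -e.
Qed.

End ValuationTheory.

Lemma valuation_map (A : comNzRingType) (L L' : orderedZmodType) (mu : valuation A L)
    (f : L -> L') :
  (forall x y, value_group mu x -> value_group mu y -> f (x + y) = f x + f y) ->
  (forall x y, value_group mu x -> value_group mu y -> (f x <= f y) = (x <= y)) ->
  exists nu : valuation A L', forall a, nu a = omap f (mu a).
Proof.
move=> fD fle.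
have vP a x : mu a = Some x -> value_group mu x by apply: val_valueP.
have p1 : omap f (mu 1) = (0 : infty L').
  by rewrite Defs.val1 /= (add_on0 (@gen_subgroup_subgroup _ _) fD).
have p0 : omap f (mu 0) = (None : infty L') by rewrite Defs.val0.
have pM a b : (omap f (mu (a * b)) : infty L') = (omap f (mu a) : infty L') + omap f (mu b).
  rewrite Defs.valM; case ea: (mu a) => [x|] //; case eb: (mu b) => [y|] //=.
  by rewrite fD //; [apply: vP ea|apply: vP eb].
have pD a b : Num.min (omap f (mu a) : infty L') (omap f (mu b)) <= omap f (mu (a + b)).
  have fle' c e : mu c <= mu e -> (omap f (mu c) : infty L') <= omap f (mu e).
    case ec: (mu c) => [x|]; case ee: (mu e) => [y|] //.
    by rewrite ileSome /= ileSome fle //; [apply: vP ec|apply: vP ee].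
  have := valD mu a b; rewrite !ge_min => /orP[|] /fle' ->; rewrite ?orbT //.
by exists (Valuation p1 p0 pM pD).
Qed.

(** * Extension of isomorphisms to torsion hulls *)


(* An isomorphism i g + m b |-> j g + m c of ordered groups extends to the
   divisible hulls. *)
Section TorsionExtension.
Variables (G W L : orderedZmodType) (i : G -> W) (j : G -> L) (b : W) (c : L).
Hypotheses (iD : {morph i : x y / x + y}) (jD : {morph j : x y / x + y}).
Hypothesis (bc : forall g m, (0 <= i g + b *~ m) = (0 <= j g + c *~ m)).

(** Graph of the extension, written without division; that it is functional follows later from the
    order. *)
Definition torsion_rel (x : W) (z : L) : Prop := exists n g m,
  x *+ n.+1 = i g + b *~ m /\ z *+ n.+1 = j g + c *~ m.

Let iMn g n : i (g *+ n) = i g *+ n.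
Proof. exact: (@add_onMn _ _ setT). Qed.
Let jMn g n : j (g *+ n) = j g *+ n.
Proof. exact: (@add_onMn _ _ setT). Qed.
Let iN g : i (- g) = - i g.
Proof. exact: (@add_onN _ _ setT). Qed.
Let jN g : j (- g) = - j g.
Proof. exact: (@add_onN _ _ setT). Qed.

Lemma torsion_rel0 : torsion_rel 0 0.
Proof.
exists 0%N, 0, 0; rewrite !mulr1n !mulr0z !addr0.
by rewrite (@add_on0 _ _ setT) // (@add_on0 _ _ setT).
Qed.

Lemma torsion_relB x y z t :
  torsion_rel x z -> torsion_rel y t -> torsion_rel (x - y) (z - t).
Proof.
move=> [n [g [m [ex ez]]]] [n' [g' [m' [ey et]]]].
(* The common denominator (n+1)(n'+1), written as a successor. *)
exists (n + n' + n * n')%N, (g *+ n'.+1 - g' *+ n.+1), (m *+ n'.+1 - m' *+ n.+1).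
have -> : ((n + n' + n * n').+1 = n.+1 * n'.+1)%N by lia.
have mzMn (V : zmodType) (u : V) (k : int) l : u *~ (k *+ l) = u *~ k *+ l.
  by rewrite -mulr_natr natz mulrzA.
rewrite !mulrnBl (mulrnA x) (mulrnA z) (mulnC n.+1) (mulrnA y) (mulrnA t).
rewrite ex ez ey et iD jD iN jN !iMn !jMn !mulrzBr !mzMn !mulrnDl !opprD.
by split; rewrite addrACA.
Qed.

Lemma torsion_relD x y z t :
  torsion_rel x z -> torsion_rel y t -> torsion_rel (x + y) (z + t).
Proof.
move=> xz yt; rewrite -[y]opprK -[t]opprK; apply: torsion_relB => //.
by rewrite -[- y]sub0r -[- t]sub0r; apply: torsion_relB => //; apply: torsion_rel0.
Qed.

Lemma torsion_rel_ge0 x z : torsion_rel x z -> (0 <= x) = (0 <= z).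
Proof.
move=> [n [g [m [ex ez]]]].
by rewrite -(olerMn2r n 0 x) -(olerMn2r n 0 z) !mul0rn ex ez bc.
Qed.

Lemma torsion_rel_le x y z t :
  torsion_rel x z -> torsion_rel y t -> (x <= y) = (z <= t).
Proof.
move=> xz yt; rewrite -(osubr_ge0 x) -(osubr_ge0 z).
exact/torsion_rel_ge0/torsion_relB.
Qed.

(** Comparing [x] with itself gives both [z <= t] and [t <= z]. *)
Lemma torsion_rel_fun x z t : torsion_rel x z -> torsion_rel x t -> z = t.
Proof.
by move=> xz xt; apply/le_anti; rewrite -(torsion_rel_le xz xt) -(torsion_rel_le xt xz) lexx.
Qed.

Lemma torsion_rel_base g m : torsion_rel (i g + b *~ m) (j g + c *~ m).
Proof. by exists 0%N, g, m; rewrite !mulr1n. Qed.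

Hypothesis Ldiv : forall (z : L) n, exists t, t *+ n.+1 = z.

(** Divisibility of [L] makes an image exist, and its uniqueness turns the pointwise choice into an
    additive map. *)
Lemma torsion_extension (X : set W) : subgroup X ->
  (forall x, X x -> exists n g m, x *+ n.+1 = i g + b *~ m) ->
  exists f : W -> L, [/\ forall x, X x -> torsion_rel x (f x),
    forall x y, X x -> X y -> f (x + y) = f x + f y &
    forall x y, X x -> X y -> (f x <= f y) = (x <= y)].
Proof.
move=> sX hX; pose f x := xget 0 [set z | torsion_rel x z].
have fP x : X x -> torsion_rel x (f x).
  move=> /hX [n [g [m e]]]; apply: (@xgetPex _ 0 [set z | torsion_rel x z]).
  by have [t et] := Ldiv (j g + c *~ m) n; exists t; exists n, g, m.
exists f; split=> // x y Xx Xy; last by rewrite -(torsion_rel_le (fP x Xx) (fP y Xy)).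
apply: (@torsion_rel_fun (x + y)); first by apply: fP; apply: subgroupD.
by apply: torsion_relD; apply: fP.
Qed.

(** Moves a valuation into [L]. The relation between old and new values is kept because, being
    functional, it later identifies individual values of [mu]. *)
Lemma valuation_transfer (A : comNzRingType) (w : valuation A W) :
  (forall f x, w f = Some x -> exists n g m, x *+ n.+1 = i g + b *~ m) ->
  exists mu : valuation A L, vequiv w mu /\
    forall f, match w f with None => mu f = None
      | Some x => exists2 z, mu f = Some z & torsion_rel x z end.
Proof.
move=> hw.
have sub : subgroup [set x | exists n g m, x *+ n.+1 = i g + b *~ m].
  split; first by have [n [g [m [e _]]]] := torsion_rel0; exists n, g, m.
  move=> x y [n [g [m e]]] [n' [g' [m' e']]].
  (* These roots only serve to invoke [torsion_relB]; the equation it yields in [L] is dropped. *)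
  have [t et] := Ldiv (j g + c *~ m) n; have [t' et'] := Ldiv (j g' + c *~ m') n'.
  have [||n2 [g2 [m2 [e2 _]]]] := @torsion_relB x y t t'.
  - by exists n, g, m.
  - by exists n', g', m'.
  by exists n2, g2, m2.
have [f [fP fD fle]] := @torsion_extension (value_group w) (@gen_subgroup_subgroup _ _)
  (gen_subgroup_sub sub (fun x ax => let: ex_intro a e := ax in hw a x e)).
have [mu muE] := valuation_map fD fle; exists mu; split.
  exact: vequiv_map muE.
move=> a; rewrite muE; case E: (w a) => [x|] //=; exists (f x) => //.
by apply: fP; apply: val_valueP E.
Qed.

End TorsionExtension.

(** * Key polynomials from comparable valuations *)


Section GradedTheory.
Variables (A : comNzRingType) (L : orderedZmodType) (mu : valuation A L).
Implicit Types (u w : gr_elt mu).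

Lemma gr_piP u w : \pi_(graded mu) u = \pi_(graded mu) w <->
  forall a, (Some a : infty L) < mu ((gr_val u)@_a - (gr_val w)@_a).
Proof.
have e : (gr_ideal (u - w)) <->
    forall a, (Some a : infty L) < mu ((gr_val u)@_a - (gr_val w)@_a).
  have vB : gr_val (u - w) = gr_val u - gr_val w by exact: (raddfB \val).
  rewrite /gr_ideal; split=> [/asboolP h a|h].
    by have := h a; rewrite vB mcoeffB.
  by apply/asboolP => a; rewrite vB mcoeffB.
split=> [h|/e h].
  by apply/e; move/eqP: h; rewrite -Quotient.idealrBE.
by apply/eqP; rewrite -Quotient.idealrBE.
Qed.

Lemma gr_pi0P u : \pi_(graded mu) u = 0 <->
  forall a, (Some a : infty L) < mu (gr_val u)@_a.
Proof.
have -> : (0 : graded mu) = \pi_(graded mu) 0 by rewrite [LHS]/GRing.zero /= /Quotient.zero; unlock.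
rewrite gr_piP; have -> : gr_val (0 : gr_elt mu) = 0 by exact: (raddf0 \val).
by split=> h a; move: (h a); rewrite mcoeff0 subr0.
Qed.

Lemma gr_piM u w : \pi_(graded mu) u * \pi_(graded mu) w = \pi_(graded mu) (u * w).
Proof.
by rewrite -[RHS]/(\pi_(Quotient.quot (Idealr.clone (gr_elt mu) (@gr_ideal _ _ mu) _)) _)
  Quotient.pi_mul.
Qed.

Lemma gr_valM u w : gr_val (u * w) = gr_val u * gr_val w.
Proof. by []. Qed.

Lemma gr_pi1 : \pi_(graded mu) 1 = 1.
Proof. by rewrite [RHS]/GRing.one /= /Quotient.one; unlock. Qed.

Lemma gr_val1 : gr_val (1 : gr_elt mu) = << 1 *g 0 >>.
Proof. exact: (rmorph1 \val). Qed.

Lemma gr_le u a : (Some a : infty L) <= mu (gr_val u)@_a.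
Proof. by have /asboolP/(_ a)[] := gr_valP u. Qed.

Lemma gr_mem u a : (gr_val u)@_a != 0 -> value_group mu a.
Proof. by have /asboolP/(_ a)[] := gr_valP u. Qed.

Lemma ga_coefUM (g : A) (x : L) (f : grpalg A L) a :
  ((<< g *g x >> : grpalg A L) * f)@_a = g * f@_(a - x).
Proof.
rewrite -[_ * _]/(ga_mul (<< g *g x >> : grpalg A L) f).
rewrite (ga_mulw (msuppU_le : (msupp << g *g x >> `<=` [fset x])%fset) (fsubset_refl _)).
rewrite big_seq_fset1.
rewrite mcoeffUU raddf_sum /=.
have [in_f|nin] := boolP (a - x \in msupp f).
  rewrite (big_fsetD1 (a - x)) //= mcoeffU subrKC eqxx mulr1n big1_fset ?addr0 //.
  move=> l; rewrite in_fsetD1 mcoeffU => /andP[ne _] _.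
  case: eqP => // e; rewrite ?mulr0n //.
  by move: ne; rewrite -e addrC addKr eqxx.
rewrite (mcoeff_outdom nin) mulr0 big1_fset // => l lf _.
rewrite mcoeffU; case: eqP => // e.
by move: nin; rewrite -e addrC addKr lf.
Qed.

Lemma initialE g a (e : mu g = Some a) :
  initial mu g = \pi_(graded mu) (GrElt (gr_monom_subproof e)).
Proof.
(* [initial] is a dependent match, so the value and the proof of its equation are generalised
   together. *)
suff H o (e' : mu g = o) : o = Some a -> (match o as x return mu g = x -> graded mu with
    | Some b => fun gb => \pi_(graded mu) (GrElt (gr_monom_subproof gb))
    | None => fun=> 0 end) e' = \pi_(graded mu) (GrElt (gr_monom_subproof e)).
  exact: (H _ erefl e).
case: o e' => [b|] // e' [eb]; subst b.
by congr (\pi_(graded mu) (GrElt _)); apply: Prop_irrelevance.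
Qed.

Lemma initial_None g : mu g = None -> initial mu g = 0.
Proof.
move=> e; suff H o (e' : mu g = o) : o = None -> (match o as x return mu g = x -> graded mu with
    | Some b => fun gb => \pi_(graded mu) (GrElt (gr_monom_subproof gb))
    | None => fun=> 0 end) e' = 0 by exact: (H _ erefl e).
by case: o e'.
Qed.

Lemma initial_eq g h a : mu g = Some a -> (Some a : infty L) < mu (g - h) ->
  initial mu g = initial mu h.
Proof.
move=> eg lt; have eh : mu h = Some a.
  by rewrite -[h](subKr g) val_addl ?valN eg // .
rewrite (initialE eg) (initialE eh); apply/gr_piP => b /=; rewrite !mcoeffU.
by case: eqP => [<-|_]; rewrite ?mulr1n // !mulr0n subrr Defs.val0.
Qed.

Lemma initialM g h a b : mu g = Some a -> mu h = Some b ->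
  initial mu (g * h) = initial mu g * initial mu h.
Proof.
move=> eg eh; have egh : mu (g * h) = Some (a + b) by rewrite Defs.valM eg eh.
rewrite (initialE eg) (initialE eh) (initialE egh) gr_piM; apply/gr_piP => c.
rewrite gr_valM; cbn [gr_val]; rewrite ga_coefUM !mcoeffU.
have -> : (b == c - a) = (a + b == c) by rewrite eq_sym subr_eq (addrC b) eq_sym.
by rewrite mulrnAr subrr Defs.val0.
Qed.

Lemma initial1 : initial mu 1 = 1.
Proof.
rewrite (initialE (Defs.val1 mu)) -gr_pi1; apply/gr_piP => c.
rewrite gr_val1; cbn [gr_val]; by rewrite subrr Defs.val0.
Qed.

Lemma initial_neq0 g a : mu g = Some a -> initial mu g != 0.
Proof.
move=> e; apply/eqP; rewrite (initialE e) => /gr_pi0P/(_ a).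
by rewrite /= mcoeffUU e ltxx.
Qed.

(** A unit generates an ideal containing 1, which [idealr_closed] excludes. *)
Lemma unit_not_irreducible g h : initial mu g * initial mu h = 1 ->
  ~ val_irreducible mu g.
Proof.
move=> gh [_ [_ + _] _]; apply/negP; rewrite negbK.
by apply/asboolP; exists (initial mu h).
Qed.

End GradedTheory.

(** Serves to pick the lowest degree in which an element of the graded algebra survives under
    [nu]. *)
Lemma seq_min (L : orderedZmodType) (s : seq L) (P : L -> Prop) :
  (exists2 x, x \in s & P x) ->
  exists m, [/\ m \in s, P m & forall y, y \in s -> P y -> m <= y].
Proof.
elim: s => [[x]//|x s IH [y ys Py]].
have [/IH [m [ms Pm hm]]|nP] := pselect (exists2 x, x \in s & P x); last first.
  have e : y = x.
    by move: ys; rewrite inE => /orP[/eqP //|ys]; case: nP; exists y.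
  subst y; exists x; rewrite mem_head; split=> // z.
  by rewrite inE => /orP[/eqP -> //|zs Pz]; case: nP; exists z.
have [[Px xm]|nx] := pselect (P x /\ x <= m).
  exists x; rewrite mem_head; split=> // z.
  by rewrite inE => /orP[/eqP -> //|zs Pz]; apply: le_trans xm _; apply: hm.
exists m; rewrite inE ms orbT; split=> // z.
rewrite inE => /orP[/eqP -> Px|]; last exact: hm.
by case/orP: (oler_total m x) => // xm; case: nx.
Qed.

(* A polynomial phi of minimal degree among those with mu phi < nu phi is a key
   polynomial: in(phi) generates the kernel of the homomorphism of graded algebras
   induced by mu <= nu, whose target is a domain. *)
Section KeyOfLe.
Variables (K : fieldType) (L : orderedZmodType) (mu nu : valuation {poly K} L).
Hypothesis le_mu_nu : vle mu nu.
Variable phi : {poly K}.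
Hypotheses (phi_monic : phi \is monic) (phi_lt : mu phi < nu phi).
Hypothesis phi_min : forall f : {poly K}, (size f < size phi)%N -> nu f = mu f.

(** If [f] were in the support of [mu], it would be in that of [nu], and reducing [phi] modulo [f]
    would change neither value of [phi]; but [mu] and [nu] agree on the remainder and differ on
    [phi]. *)
Lemma key_fin (f : {poly K}) : f != 0 -> (size f < size phi)%N -> mu f != None.
Proof.
move=> f0 sf; apply/eqP => ef.
have nf : nu f = None by rewrite phi_min.
have valr (rho : valuation {poly K} L) : rho f = None -> rho phi != None ->
    rho (phi %% f) = rho phi.
  move=> rf nphi; have -> : phi %% f = phi - phi %/ f * f.
    by rewrite {2}(divp_eq phi f) addrC addKr.
  have e : rho (- (phi %/ f * f)) = None by rewrite valN Defs.valM rf; case: (rho _).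
  by rewrite val_addl // e; case: (rho phi) nphi.
have sr : (size (phi %% f)%R < size phi)%N by apply: ltn_trans sf; rewrite ltn_modp.
have fin : mu phi != None by apply/eqP => e; move: phi_lt; rewrite e; case: (nu phi).
have := phi_min sr; rewrite (valr mu) //.
have [e|/eqP ne] := pselect (nu phi = None).
  have -> : nu (phi %% f) = None.
    rewrite -[phi %% f](addKr (phi %/ f * f)) -divp_eq.
    apply/eqP; rewrite eq_le ileNone /=; apply: le_trans (valD nu _ _).
    by rewrite le_min valN Defs.valM nf e; case: (nu _).
  by move=> e'; move: fin; rewrite -e'.
by rewrite (valr nu) // => e; move: phi_lt; rewrite e ltxx.
Qed.

(** Otherwise the remainder dominates for both valuations, so [mu] and [nu] agree on [phi * q]; yet
    [nu] is strictly larger there, since it is on [phi]. *)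
Lemma key_quot f a : mu f = Some a -> mu f < nu f ->
  (Some a : infty L) < mu (f - phi * (f %/ phi)).
Proof.
have [alpha ea] : exists alpha, mu phi = Some alpha.
  by case: (mu phi) (phi_lt) => [x|]; [exists x|case: (nu phi)].
move=> ef lt; set q := f %/ phi; set r := f - _.
have er : r = f %% phi by rewrite /r mulrC {1}(divp_eq f phi) addrC addKr.
have nr : nu r = mu r by rewrite er phi_min // ltn_modp monic_neq0.
rewrite ltNge; apply/negP; rewrite -ef => le.
have eq : phi * q = f - r by rewrite /r opprB addrC subrK.
have n1 : nu (phi * q) = mu r.
  by rewrite eq addrC val_addl valN nr //; apply: le_lt_trans lt.
have m1 : mu (phi * q) = mu r.
  apply/le_anti; rewrite -{1}n1 le_mu_nu /= eq.
  by apply: le_trans (valB mu _ _); rewrite le_min lexx le.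
have [b eb] : exists b, mu q = Some b.
  move: m1; rewrite Defs.valM ea; case: (mu q) => [b|]; first by exists b.
  by move=> e; move: le; rewrite -e ef.
have : (Some (b + alpha) : infty L) < nu q + nu phi.
  by apply: ilt_add; rewrite -?ea -?eb.
rewrite (addrC (nu q)) -Defs.valM n1 -m1 Defs.valM ea eb iaddSome.
by rewrite addrC ltxx.
Qed.

(** The right side describes the kernel. To divide a kernel element, each coefficient is divided by
    [phi], and [key_quot] makes the remainders vanish in the graded algebra. *)
Lemma key_divP (u : gr_elt mu) :
  (exists z, \pi_(graded mu) u = initial mu phi * z) <->
  forall a, (Some a : infty L) < nu (gr_val u)@_a.
Proof.
have [alpha ea] : exists alpha, mu phi = Some alpha.
  by case: (mu phi) (phi_lt) => [x|]; [exists x|case: (nu phi)].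
rewrite (initialE ea); split=> [[z]|h].
  rewrite -[z]reprK gr_piM => /gr_piP + a => /(_ a).
  rewrite gr_valM ga_coefUM; set z' := repr z => lt1.
  rewrite -[(gr_val u)@_a](subrK (phi * (gr_val z')@_(a - alpha))).
  apply: lt_le_trans (valD nu _ _); rewrite lt_min (lt_le_trans lt1 (le_mu_nu _)) /=.
  rewrite mulrC Defs.valM -[in Some a](subrK alpha a).
  apply: ilt_add; last by rewrite -ea.
  exact: le_trans (gr_le _ _) (le_mu_nu _).
(* A coefficient of value above its degree is already zero in the graded algebra, so its quotient is
   taken to be 0. *)
pose q a : {poly K} := if mu (gr_val u)@_a == Some a then (gr_val u)@_a %/ phi else 0.
have q_lt a : (Some a : infty L) < mu ((gr_val u)@_a - phi * q a).
  rewrite /q; case: eqP => [e|/eqP ne]; first by apply: key_quot => //; rewrite e.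
  by rewrite mulr0 subr0 lt_neqAle eq_sym ne gr_le.
have q_le a : (Some (a - alpha) : infty L) <= mu (q a).
  have : (Some a : infty L) <= mu (phi * q a).
    rewrite -[phi * q a](subKr (gr_val u)@_a); apply: le_trans (valB mu _ _).
    by rewrite le_min gr_le ltW.
  rewrite Defs.valM ea; case: (mu (q a)) => [b|] //.
  by rewrite iaddSome !ileSome -(olerD2r alpha (a - alpha)) subrK addrC.
have q0 a : q a != 0 -> (gr_val u)@_a != 0.
  by apply: contra_neq; rewrite /q => ->; rewrite div0p; case: ifP.
pose Z : grpalg {poly K} L := \sum_(a <- msupp (gr_val u)) << q a *g a - alpha >>.
have ZE b : Z@_b = q (b + alpha).
  rewrite raddf_sum /=.
  have [bin|bnin] := boolP (b + alpha \in msupp (gr_val u)).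
    rewrite (big_fsetD1 (b + alpha)) //= mcoeffU addrK eqxx mulr1n big1_fset ?addr0 //.
    move=> l; rewrite in_fsetD1 => /andP[ne _] _; rewrite mcoeffU.
    by case: eqP => // e; move: ne; rewrite -e subrK eqxx.
  rewrite big1_fset => [|l lu _]; last first.
    rewrite mcoeffU; case: eqP => // e.
    by move: bnin; rewrite -e subrK lu.
  by apply/esym/eqP/contraT => /q0; rewrite mcoeff_outdom ?eqxx.
have ZP : gr_sub mu Z.
  apply/asboolP => a; rewrite ZE; split.
    move=> /q0/gr_mem va; rewrite -(addrK alpha a).
    exact: (value_group_subgroup mu).2 va (val_valueP ea).
  by have := q_le (a + alpha); rewrite addrK.
exists (\pi_(graded mu) (GrElt ZP)); rewrite gr_piM; apply/gr_piP => a.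
by rewrite gr_valM ga_coefUM /= ZE subrK.
Qed.

Lemma key_of_le : key_poly mu phi.
Proof.
have [alpha ea] : exists alpha, mu phi = Some alpha.
  by case: (mu phi) (phi_lt) => [x|]; [exists x|case: (nu phi)].
split=> //.
  move=> f f0 sf [z ez].
  case ef : (mu f) (key_fin f0 sf) => [b|] // _.
  (* Divisibility by [phi] would put the initial term of [f] in the kernel, although [nu f = mu f]
     in degrees below that of [phi]. *)
  have /key_divP/(_ b) : exists z,
      \pi_(graded mu) (GrElt (gr_monom_subproof ef)) = initial mu phi * z.
    by exists z; rewrite -ez (initialE ef).
  by rewrite /= mcoeffUU phi_min // ef ltxx.
split; first exact: initial_neq0 ea.
  split.
  - by apply/asboolP; exists 0; rewrite mulr0.
  - apply/negP => /asboolP[z]; rewrite -gr_pi1 => ez.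
    have /key_divP/(_ 0) : exists z, \pi_(graded mu) 1 = initial mu phi * z by exists z.
    by rewrite gr_val1 mcoeffUU Defs.val1 ltxx.
  - move=> c x y /asboolP[z ->] /asboolP[z' ->]; apply/asboolP.
    by exists (c * z + z'); rewrite mulrDr mulrCA.
move=> x y; rewrite -[x]reprK -[y]reprK gr_piM.
move: (repr x) (repr y) => {x y} u w /asboolP /key_divP h.
apply/orP; have [hu|nu_] := pselect (forall a, (Some a : infty L) < nu (gr_val u)@_a).
  by left; apply/asboolP/key_divP.
have [hw|nw] := pselect (forall a, (Some a : infty L) < nu (gr_val w)@_a).
  by right; apply/asboolP/key_divP.
have nle (t : gr_elt mu) a : (Some a : infty L) <= nu (gr_val t)@_a.
  exact: le_trans (gr_le _ _) (le_mu_nu _).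
(* The lowest degree [m] in which [t] is nonzero modulo the kernel. *)
have ex (t : gr_elt mu) : ~ (forall a, (Some a : infty L) < nu (gr_val t)@_a) ->
    exists m, [/\ m \in msupp (gr_val t), nu (gr_val t)@_m = Some m &
      forall a, a < m -> (Some a : infty L) < nu (gr_val t)@_a].
  move=> nt; have [|m [ms em hm]] := @seq_min L (msupp (gr_val t))
    (fun a => nu (gr_val t)@_a = Some a).
    apply: contrapT => nex; apply: nt => a; rewrite lt_neqAle nle andbT.
    apply/eqP => e; apply: nex; exists a => //.
    by rewrite -mcoeff_neq0; apply/eqP => e0; move: e; rewrite e0 Defs.val0.
  exists m; split=> // a am; rewrite lt_neqAle nle andbT; apply/eqP => e.
  have : m <= a.
    apply: hm => //; rewrite -mcoeff_neq0; apply/eqP => e0.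
    by move: e; rewrite e0 Defs.val0.
  by apply/negP; rewrite -oltNge.
have [m [mu_ em hm]] := ex u nu_; have [n [nw_ en hn]] := ex w nw.
(* If [k + l = m + n] with [k != m], then [k < m] or [l < n], and one factor lies above its
   degree. *)
have gt k l : k != m ->
    (Some (m + n) : infty L) < nu (((gr_val u)@_k * (gr_val w)@_l) *+ (k + l == m + n)).
  move=> km; case: eqP => [e|_]; last by rewrite mulr0n Defs.val0.
  rewrite mulr1n -e; case/orP: (oler_total k m) => [le|mk].
    have lt : k < m by rewrite lt_neqAle km.
    by rewrite mulrC Defs.valM addrC; apply: ilt_add => //; apply: hm.
  rewrite Defs.valM; apply: ilt_add => //; apply: hn.
  rewrite -(oltrD2l m) -e -!(addrC l) oltrD2l.
  by rewrite lt_neqAle eq_sym km.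
(* In degree [m + n] the product of the two lowest coefficients has exact value [m + n] and all
   other terms exceed it, so the product of [u] and [w] is not in the kernel. *)
exfalso; have := h (m + n); rewrite gr_valM ga_coefM (big_fsetD1 m) //=.
rewrite (big_fsetD1 n) //= eqxx mulr1n [X in _ + X + _]big1_fset ?addr0 => [|l]; last first.
  rewrite in_fsetD1 => /andP[ln _] _; rewrite (inj_eq (addrI m)) (negPf ln) //.
rewrite val_addl Defs.valM em en ?ltxx //.
rewrite iaddSome big_seq; elim/big_ind: _ => [|x y hx hy|k].
- by rewrite Defs.val0.
- by apply: lt_le_trans (valD nu _ _); rewrite lt_min hx.
- by rewrite in_fsetD1 => /andP[km _]; apply: val_gt_sum => l; apply: gt.
Qed.

End KeyOfLe.

(** * Incommensurable extensions *)


Definition torsion_over (G L : orderedZmodType) (i : G -> L) : set L :=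
  [set x | exists n g, x *+ n.+1 = i g].

Lemma torsion_over_subgroup (G L : orderedZmodType) (i : G -> L) :
  {morph i : x y / x + y} -> subgroup (torsion_over i).
Proof.
move=> iD; have i0 : i 0 = 0 by exact: (@add_on0 _ _ setT).
have iN g : i (- g) = - i g by exact: (@add_onN _ _ setT).
have iMn g n : i (g *+ n) = i g *+ n by exact: (@add_onMn _ _ setT).
split; first by exists 0%N, 0; rewrite mulr1n.
move=> x y [n [g ex]] [n' [g' ey]].
exists (n + n' + n * n')%N, (g *+ n'.+1 - g' *+ n.+1).
have -> : ((n + n' + n * n').+1 = n.+1 * n'.+1)%N by lia.
by rewrite mulrnBl (mulrnA x) (mulnC n.+1) (mulrnA y) ex ey iD iN !iMn.
Qed.

Lemma torsion_over_pure (G L : orderedZmodType) (i : G -> L) x n :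
  torsion_over i (x *+ n.+1) -> torsion_over i x.
Proof.
move=> [m [g e]]; exists (n + m + n * m)%N, g.
have -> : ((n + m + n * m).+1 = n.+1 * m.+1)%N by lia.
by rewrite mulrnA.
Qed.

Section Incommensurable.
Variables (K : fieldType) (G L : orderedZmodType) (v : valuation K G) (i : G -> L).
Hypothesis iD : {morph i : x y / x + y}.
Local Notation C := (torsion_over i).
Implicit Types (f g a b q r psi : {poly K}).

Let sC : subgroup C := torsion_over_subgroup iD.

Section Generator.
Variable mu : valuation {poly K} L.
Hypothesis mu_tree : tree v i mu.
Variables (phi : {poly K}) (gam : L).
Hypotheses (phi_monic : phi \is monic) (phi_val : mu phi = Some gam) (gamC : ~ C gam).
Hypothesis phi_min : forall (f : {poly K}) x, (size f < size phi)%N -> mu f = Some x -> C x.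

Lemma const_torsion (c : K) x : mu c%:P = Some x -> C x.
Proof.
rewrite mu_tree; case: (v c) => [g|] //= [<-].
by exists 0%N, g; rewrite mulr1n.
Qed.

Lemma size_generator : (1 < size phi)%N.
Proof.
rewrite ltnNge; apply/negP => /size1_polyC e; apply: gamC.
by apply: (@const_torsion phi`_0); rewrite -e.
Qed.

(** If [f] had infinite value, [phi] modulo [f] would have value [gam] in a degree where only
    torsion values occur. *)
Lemma small_value f : f != 0 -> (size f < size phi)%N -> exists2 x, mu f = Some x & C x.
Proof.
move=> f0 sf; case ef: (mu f) => [x|]; first by exists x => //; apply: phi_min ef.
have sr : (size (phi %% f)%R < size phi)%N by apply: ltn_trans sf; rewrite ltn_modp.
case: gamC; apply: phi_min sr _.
have -> : phi %% f = phi - phi %/ f * f by rewrite {2}(divp_eq phi f) addrC addKr.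
have e : mu (- (phi %/ f * f)) = None by rewrite valN Defs.valM ef; case: (mu _).
by rewrite val_addl // e phi_val.
Qed.

Lemma shift_not_torsion c k : C c -> ~ C (c + gam *+ k.+1).
Proof.
move=> Cc CD; apply: gamC; apply: (@torsion_over_pure _ _ _ _ k).
by rewrite -[gam *+ _](addKr c) addrC; apply: sC.2.
Qed.

(** Induction on the degree by division with remainder: the quotient part has a non-torsion value
    and the remainder a torsion one, so the two never tie. *)
Lemma value_decomposition f : f != 0 ->
  exists c k, C c /\ mu f = Some (c + gam *+ k).
Proof.
have [n] := ubnP (size f); elim: n f => // n IH f sf f0.
have [lt|ge] := ltnP (size f) (size phi).
  by have [x ex Cx] := small_value f0 lt; exists x, 0%N; rewrite mulr0n addr0.
have sq : (size (f %/ phi)%R < n)%N.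
  move: ge sf size_generator; rewrite size_divp ?monic_neq0 //.
  by move: (size f) (size phi) => k l; lia.
have q0 : f %/ phi != 0 by rewrite divpN0 ?monic_neq0.
have [c [k [Cc ec]]] := IH _ sq q0.
have e1 : mu (f %/ phi * phi) = Some (c + gam *+ k.+1).
  by rewrite Defs.valM ec phi_val iaddSome mulrSr addrA.
rewrite (divp_eq f phi).
have [->|r0] := eqVneq (f %% phi) 0; first by exists c, k.+1; rewrite addr0.
have [x ex Cx] : exists2 x, mu (f %% phi) = Some x & C x.
  by apply: small_value; rewrite // ltn_modp monic_neq0.
rewrite val_add_neq e1 ex.
  by case: leP => _; [exists c, k.+1|exists x, 0%N; rewrite mulr0n addr0].
by apply/eqP => -[e]; apply: (shift_not_torsion (k := k) Cc); rewrite e.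
Qed.

Lemma mul_not_torsion q x : mu (q * phi) = Some x -> ~ C x.
Proof.
have [->|q0] := eqVneq q 0; first by rewrite mul0r Defs.val0.
have [c [k [Cc ec]]] := value_decomposition q0.
rewrite Defs.valM ec phi_val iaddSome -addrA -mulrSr => -[<-].
exact: shift_not_torsion.
Qed.

Lemma val_mulD q r : (size r < size phi)%N ->
  mu (q * phi + r) = Num.min (mu (q * phi)) (mu r).
Proof.
move=> sr; have [->|r0] := eqVneq r 0.
  by rewrite addr0 Defs.val0 min_l // ileNone.
have [x ex Cx] := small_value r0 sr.
rewrite val_add_neq // ex; apply/eqP => e; exact: (mul_not_torsion e).
Qed.

(** The value of the product is torsion, so the minimum in [val_mulD] is attained by the remainder,
    and strictly. *)
Lemma val_mulmod a b : (size a < size phi)%N -> (size b < size phi)%N ->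
  a != 0 -> b != 0 ->
  mu (a * b) = mu ((a * b) %% phi) /\ mu (a * b) < mu ((a * b) %/ phi * phi).
Proof.
move=> sa sb a0 b0; have [x ex Cx] := small_value a0 sa.
have [y ey Cy] := small_value b0 sb.
have e : mu (a * b) = Some (x + y) by rewrite Defs.valM ex ey.
have Cxy : C (x + y) by apply: subgroupD.
have := e; rewrite {1}(divp_eq (a * b) phi) val_mulD; last by rewrite ltn_modp monic_neq0.
rewrite minEle; case: ifP => [_ e'|/negbT nle er]; first by case: (mul_not_torsion e' Cxy).
by split; rewrite ?er // ltNge e -er nle.
Qed.

(** This sends [phi] to infinity. Multiplicativity reduces to remainders, where [val_mulmod] says
    that reducing a product modulo [phi] keeps its value. *)
Lemma mod_valuation : exists2 nu : valuation {poly K} L,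
  forall f, nu f = mu (f %% phi) & vle mu nu.
Proof.
have p0 := monic_neq0 phi_monic.
have smod f : (size (f %% phi)%R < size phi)%N by rewrite ltn_modp.
have v1 : mu (1 %% phi) = 0.
  by rewrite modp_small ?Defs.val1 // size_poly1 size_generator.
have v0 : mu (0 %% phi) = None by rewrite mod0p Defs.val0.
have vM f g : mu ((f * g) %% phi) = mu (f %% phi) + mu (g %% phi).
  have -> : (f * g) %% phi = ((f %% phi) * (g %% phi)) %% phi.
    by rewrite modp_mul (mulrC (f %% phi)) modp_mul mulrC.
  have [->|f0] := eqVneq (f %% phi) 0.
    by rewrite mul0r mod0p Defs.val0.
  have [->|g0] := eqVneq (g %% phi) 0.
    by rewrite mulr0 mod0p Defs.val0; case: (mu _).
  by rewrite -Defs.valM; have [-> _] := val_mulmod (smod f) (smod g) f0 g0.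
have vD f g : Num.min (mu (f %% phi)) (mu (g %% phi)) <= mu ((f + g) %% phi).
  by rewrite modpD; apply: valD.
exists (Valuation v1 v0 vM vD) => // f /=.
by rewrite {1}(divp_eq f phi) val_mulD // ge_min lexx orbT.
Qed.

Lemma key_generator : key_poly mu phi.
Proof.
have [nu nuE le] := mod_valuation.
apply: (@key_of_le _ _ mu nu) => //.
  by rewrite nuE modpp Defs.val0 phi_val.
by move=> f sf; rewrite nuE modp_small.
Qed.

(** A proper factor of [phi] would split [gam] into torsion values, so [a] is coprime to [phi]. A
    Bezout inverse modulo [phi] inverts the initial term, the multiple of [phi] left over having
    larger value. *)
Lemma unit_small a : a != 0 -> (size a < size phi)%N ->
  exists b, initial mu a * initial mu b = 1.
Proof.
move=> a0 sa; have p0 := monic_neq0 phi_monic.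
have cop : coprimep a phi.
  rewrite /coprimep eqn_leq andbC lt0n size_poly_eq0 gcdp_eq0 (negPf a0) /=.
  rewrite leqNgt; apply/negP => sd; set d := gcdp a phi in sd.
  have e : phi = phi %/ d * d by rewrite divpK ?dvdp_gcdr.
  have d0 : d != 0 by rewrite gcdp_eq0 negb_and a0.
  have sdp : (size d < size phi)%N by apply: leq_ltn_trans sa; rewrite leq_gcdpl.
  have q0 : phi %/ d != 0 by rewrite divpN0 // ltnW.
  have sqp : (size (phi %/ d)%R < size phi)%N.
    rewrite size_divp //; move: sd sdp.
    by move: (size d) (size phi) => k l; lia.
  have [x ex Cx] := small_value d0 sdp; have [y ey Cy] := small_value q0 sqp.
  move: phi_val; rewrite e Defs.valM ex ey iaddSome => -[eg].
  by apply: gamC; rewrite -eg; apply: subgroupD.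
have [[u w] /= uw] := Bezout_eq1_coprimepP _ _ cop.
have sb : (size (u %% phi)%R < size phi)%N by rewrite ltn_modp.
have em : (a * (u %% phi)) %% phi = 1.
  have -> : 1 = (u * a + w * phi) %% phi by rewrite uw modp_small // size_poly1 size_generator.
  by rewrite modp_mul modpD modp_mull addr0 mulrC.
have b0 : u %% phi != 0.
  by apply: contra_eq_neq em => ->; rewrite mulr0 mod0p eq_sym oner_neq0.
have [] := val_mulmod sa sb a0 b0; rewrite em Defs.val1 => e1 lt.
have [x ex _] := small_value a0 sa; have [y ey _] := small_value b0 sb.
exists (u %% phi); rewrite -(initialM ex ey) -initial1; apply: (initial_eq e1).
rewrite {1}(divp_eq (a * (u %% phi)) phi) em addrK.
by apply: le_lt_trans lt; rewrite e1.
Qed.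

(** The initial term of a key polynomial is no unit, hence never that of a nonzero polynomial of
    degree below [phi]. In equal degree, [psi - phi] is such a polynomial, so it cannot dominate
    [phi]. *)
Lemma key_value psi : key_poly mu psi ->
  (size phi <= size psi)%N /\ (size psi = size phi -> mu psi = Some gam).
Proof.
move=> [psi_monic _ irr].
have small a : a != 0 -> (size a < size phi)%N -> mu a < mu (psi - a) -> False.
  move=> a0 sa; have [x ex _] := small_value a0 sa; rewrite ex => lt.
  have [b eb] := unit_small a0 sa; apply: (@unit_not_irreducible _ _ mu psi b) irr.
  rewrite -eb (@initial_eq _ _ mu psi a x) //.
  by rewrite -[psi](subrK a) addrC val_addl ex.
have s : (size phi <= size psi)%N.
  rewrite leqNgt; apply/negP => sp; apply: (small psi) => //; first exact: monic_neq0.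
  (* With [a = psi] the difference is 0, of infinite value. *)
  have [x ex _] := small_value (monic_neq0 psi_monic) sp.
  by rewrite subrr Defs.val0 ex.
split=> // es; pose a := psi - phi.
have sa : (size a < size phi)%N.
  have lc : a`_(size phi).-1 = 0.
    move/monicP: phi_monic; move/monicP: psi_monic; rewrite /lead_coef es => e1 e2.
    by rewrite coefB e1 e2 subrr.
  have sp0 := size_generator.
  have : (size a <= (size phi).-1)%N.
    apply/leq_sizeP => k; rewrite leq_eqVlt => /orP[/eqP <- //|lk].
    have lk' : (size phi <= k)%N by case: (size phi) sp0 lk.
    by rewrite coefB !nth_default ?subrr ?es.
  by case: (size phi) sp0.
have epsi : psi = 1 * phi + a by rewrite mul1r /a subrKC.
rewrite epsi val_mulD // mul1r phi_val; apply: min_l.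
have [->|a0] := eqVneq a 0; first by rewrite Defs.val0 ileNone.
rewrite leNgt; apply/negP => lt; apply: (small a a0 sa).
by rewrite epsi mul1r addrK phi_val.
Qed.

Lemma singular_value_generator : singular_value mu = Some gam.
Proof.
rewrite /singular_value; case: xgetP => [a _ [psi [key_psi psi_min ->]]|h].
  have [s1 ->] // := key_value key_psi.
  by apply/eqP; rewrite eqn_leq s1 psi_min //; apply: key_generator.
case: (h (mu phi)); exists phi; split=> //; first exact: key_generator.
by move=> psi /key_value[].
Qed.

End Generator.

(** Take minimal degree among non-torsion values and divide by the leading coefficient, whose value
    is torsion. *)
Lemma generator_exists (mu : valuation {poly K} L) : tree v i mu ->
  (exists f x, mu f = Some x /\ ~ C x) ->
  exists phi gam, [/\ phi \is monic, mu phi = Some gam, ~ C gam &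
    forall (f : {poly K}) x, (size f < size phi)%N -> mu f = Some x -> C x].
Proof.
move=> mu_tree ex.
have exn : exists n, `[< exists f x, [/\ size f = n, mu f = Some x & ~ C x] >].
  by have [f [x [e nC]]] := ex; exists (size f); apply/asboolP; exists f, x.
case: (ex_minnP exn) => n /asboolP[f [x [sf ef nC]]] hmin.
have f0 : f != 0 by apply/eqP => e; move: ef; rewrite e Defs.val0.
have lc0 : (lead_coef f)^-1 != 0 by rewrite invr_eq0 lead_coef_eq0.
have [c ec] : exists c, mu (lead_coef f)^-1%:P = Some c.
  case E: (mu _) => [c|]; first by exists c.
  have := Defs.val1 mu; rewrite -[1 in LHS]/(1%:P) -(mulVf (x := lead_coef f)) ?lead_coef_eq0 //.
  by rewrite polyCM Defs.valM E.
exists ((lead_coef f)^-1 *: f), (c + x); split.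
- by rewrite monicE lead_coefZ mulVf // lead_coef_eq0.
- by rewrite -mul_polyC Defs.valM ec ef.
- have Cc := const_torsion mu_tree ec.
  by move=> Ccx; apply: nC; rewrite -[x](addKr c) addrC; apply: sC.2.
- move=> g y; rewrite size_scale // sf => sg ey; apply: contrapT => nCy.
  suff : (n <= size g)%N by rewrite leqNgt sg.
  by apply/hmin/asboolP; exists g, y.
Qed.
End Incommensurable.

(** * Filling cuts of a Hahn product *)


(** Completeness of the reals fills a gap within a single coefficient. *)
Lemma realgrp_between (R : realType) (P Q : set (realgrp R)) :
  P !=set0 -> Q !=set0 -> (forall x y, P x -> Q y -> x < y) ->
  exists r : realgrp R, (forall x, P x -> x <= r) /\ (forall y, Q y -> r <= y).
Proof.
move=> P0 [y0 Qy0] PQ; exists (sup (P : set R)); split=> [x Px|y Qy].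
  apply: (@ub_le_sup R) => //; exists y0 => z Pz; exact: ltW (PQ _ _ Pz Qy0).
by apply: (@ge_sup R) => // x Px; apply: ltW (PQ _ _ Px Qy).
Qed.

Section HahnOrder.
Variables (d : Order.disp_t) (I : orderType d) (Q : I -> orderedZmodType).
Implicit Types f g : hahn Q.

Lemma hahn_ltP f g : f < g <-> hahn_lt f g.
Proof.
rewrite lt_neqAle; split=> [/andP[/eqP ne /asboolP[//|//]]|lt].
apply/andP; split; last by apply/asboolP; right.
by apply/eqP => e; subst g; apply: hahn_lt_irr lt.
Qed.

Lemma hahnMn f n i : (f *+ n) i = f i *+ n.
Proof. by elim: n => [|n IH] //; rewrite !mulrS -IH. Qed.

(** Otherwise let [p <= i] be where [f] and [g] first differ, and [q] where [g] and [k] do, if at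
    all; every relative position of [p] and [q] contradicts the agreement of [f] and [k] up to
    [i]. *)
Lemma hahn_sandwich f g k i : f <= g -> g <= k ->
  (forall j, (j <= i)%O -> f j = k j) -> forall j, (j <= i)%O -> f j = g j.
Proof.
move=> /asboolP[->//|[p [fg ltp]]] gk fk j ji; case: (ltP j p) => [|pj]; first exact: fg.
have pi := le_trans pj ji; exfalso; move: gk => /asboolP[e|[q [gk ltq]]].
  by subst k; move: ltp; rewrite fk // ltxx.
case: (ltgtP p q) => [pq|qp|e].
- by move: ltp; rewrite gk // fk // ltxx.
- by move: ltq; rewrite -fg // fk ?ltxx // (le_trans _ pi) // ltW.
- by subst q; move: (lt_trans ltp ltq); rewrite fk // ltxx.
Qed.

End HahnOrder.

Definition lt_on (d : Order.disp_t) (I : orderType d) (V : orderedZmodType) (S : set I)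
    (f g : I -> V) : Prop :=
  exists j, [/\ S j, forall k, (k < j)%O -> f k = g k & f j < g j].

Section Cut.
Variables (d : Order.disp_t) (I : orderType d) (R : realType).
Local Notation V := (realgrp R).
Local Notation H := (hahn (fun _ : I => V)).
Local Notation L := (hahn (fun _ : bigI I => V)).

Lemma small_ext_wo (del : H) (S : initSeg I) (c : V) :
  wo_chain <=%O [pred x : bigI I | (match x with Elt i => del i
    | Cut T => if `[< T = S >] then c else 0 end) != 0].
Proof.
apply/wo_chainP => B hB [b Bb].
have [/(wo_chain_min (hahn_wo del)) min|] := pselect ([set i | B (Elt i)] !=set0).
  have [|m Bm hm] := min; first by move=> i /= /hB.
  have [BS|nBS] := pselect (B (Cut S)).
    exists (Order.min (Elt m) (Cut S)); first by rewrite minEle; case: ifP.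
    case=> [i|T] Bx; first by rewrite ge_min; apply/orP; left; apply: hm.
    have := hB _ Bx; rewrite inE /=; case: asboolP => [-> _|_]; last by rewrite eqxx.
    by rewrite ge_min lexx orbT.
  exists (Elt m) => // -[i|T] Bx; first exact: hm.
  have := hB _ Bx; rewrite inE /=; case: asboolP => [e _|_]; last by rewrite eqxx.
  by subst T.
move=> nE; exists b => // x Bx.
have eS z : B z -> z = Cut S.
  case: z => [i|T] Bz; first by case: nE; exists i.
  by have := hB _ Bz; rewrite inE /=; case: asboolP => [->|_]; rewrite ?eqxx.
by rewrite (eS _ Bb) (eS _ Bx).
Qed.

(** The function is read off from [small_ext_wo]: [del] on [I], [c] at the cut [S] and 0 at all
    other cuts. *)
Definition small_ext_elt (del : H) (S : initSeg I) (c : V) : L :=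
  Hahn (@small_ext_wo del S c).

Lemma small_ext_elt_mem del S c : small_ext_reals (small_ext_elt del S c).
Proof.
exists S => // -[i|T] //=; by case: asboolP => [->|_]; rewrite ?eqxx.
Qed.

Lemma ext0_below_elt (f del : H) (S : initSeg I) c j : (S : set I) j ->
  (forall k, (k < j)%O -> f k = del k) ->
  forall x, (x < Elt j)%O -> ext0 f x = small_ext_elt del S c x.
Proof.
move=> Sj fd [k|T] lt /=; first by apply: fd; move: lt; rewrite !ltNge.
case: asboolP => // e; subst T.
by move: (ltW lt) => /asboolP.
Qed.

Lemma ext0_below_cut (f del : H) (S : initSeg I) c :
  (forall k, (S : set I) k -> f k = del k) ->
  forall x, (x < Cut S)%O -> ext0 f x = small_ext_elt del S c x.
Proof.
move=> fd [k|T] lt /=; first by apply: fd; apply/asboolP; exact: ltW lt.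
by case: asboolP => // e; subst T; rewrite ltxx in lt.
Qed.

Lemma ext0_lt (f del : H) (S : initSeg I) c :
  lt_on S f del \/ (forall k, (S : set I) k -> f k = del k) /\ 0 < c ->
  ext0 f < small_ext_elt del S c.
Proof.
move=> [[j [Sj e lt]]|[e c0]]; apply/hahn_ltP.
  by exists (Elt j); split; first exact: ext0_below_elt.
exists (Cut S); split; first exact: ext0_below_cut.
by rewrite /= asboolT.
Qed.

Lemma ext0_gt (f del : H) (S : initSeg I) c :
  lt_on S del f \/ (forall k, (S : set I) k -> f k = del k) /\ c < 0 ->
  small_ext_elt del S c < ext0 f.
Proof.
move=> [[j [Sj e lt]]|[e c0]]; apply/hahn_ltP.
  exists (Elt j); split=> // x xj; apply/esym; apply: ext0_below_elt xj => // k /e -> //.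
exists (Cut S); split; first by move=> x xS; apply/esym; apply: ext0_below_cut xS.
by rewrite /= asboolT.
Qed.

Section CutExists.
Variables A B : set H.
Hypothesis AB : forall a b, A a -> B b -> a < b.

Definition cut_agree (i : I) : Prop :=
  exists a b, [/\ A a, B b & forall k, (k <= i)%O -> a k = b k].

Lemma cut_agree_down i j : cut_agree j -> (i <= j)%O -> cut_agree i.
Proof.
by move=> [a [b [Aa Bb e]]] ij; exists a, b; split=> // k ki; apply/e/(le_trans ki).
Qed.

Definition cut_seg : initSeg I := InitSeg cut_agree_down.
Local Notation J := (cut_seg : set I).

(** Each index [i] of the segment takes its coefficient from an element of [A] that agrees with one
    of [B] up to [i]; [hahn_sandwich] makes these choices coherent. *)
Lemma cut_center : exists del : H, (forall i, ~ J i -> del i = 0) /\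
  forall i, J i -> exists a b, [/\ A a, B b &
    forall k, (k <= i)%O -> a k = b k /\ del k = a k].
Proof.
have /choice [w wP] : forall i, exists a : H, J i ->
    exists b, [/\ A a, B b & forall k, (k <= i)%O -> a k = b k].
  move=> i; have [[a [b h]]|nJ] := pselect (J i); first by exists a => _; exists b.
  by exists 0.
pose del i : V := if pselect (J i) then w i i else 0.
have delP i : J i -> exists a b, [/\ A a, B b &
    forall k, (k <= i)%O -> a k = b k /\ del k = a k].
  move=> Ji; have [a [b [Aa Bb e]]] := Ji; exists a, b; split=> // k ki.
  have Jk : J k by apply: cut_agree_down ki.
  rewrite /del; case: pselect => //= _; have [b' [Aa' Bb' e']] := wP _ Jk.
  split; first exact: e.
  case/orP: (oler_total a (w k)) => le.
    by apply/esym; apply: (hahn_sandwich le (ltW (AB Aa' Bb)) e).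
  by apply: (hahn_sandwich le (ltW (AB Aa Bb')) e').
have wo : wo_chain <=%O [pred i | del i != 0].
  apply/wo_chainP => X hX [x Xx].
  have Jx : J x by move: (hX _ Xx); rewrite inE /del; case: pselect => //=; rewrite eqxx.
  (* Up to [x] the function coincides with a Hahn series, which provides the least support point. *)
  have [a [b [_ _ e]]] := delP _ Jx.
  have [|| m [Xm mx] hm] := wo_chain_min (B := [set y | X y /\ (y <= x)%O]) (hahn_wo a).
  - by move=> y [Xy yx]; rewrite inE -(e _ yx).2; apply: hX.
  - by exists x.
  exists m => // y Xy; case: (leP y x) => [yx|/ltW]; first exact: hm.
  exact: le_trans.
exists (Hahn wo); split=> // i nJ /=; rewrite /del; case: pselect => //.
Qed.

(* On J, where elements on both sides of the cut still agree, gam must follow their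
   common coefficients del. If both A and B have elements equal to del on J, they
   separate at m = min (I \ J), where gam takes a value r between their
   coefficients; otherwise one side has no such element. In all cases the ties are
   broken by a coefficient 1 or -1 at the new index i_S placed just after J, or
   just after m. *)
Lemma small_ext_cut : exists2 gam, small_ext_reals gam &
  (forall a, A a -> ext0 a < gam) /\ (forall b, B b -> gam < ext0 b).
Proof.
have [del [del0 delP]] := cut_center.
pose agr (f : H) := forall k, J k -> f k = del k.
(* An element of [A] that leaves [del] at [i] in the segment is not squeezed between [a] and [b], so
   it lies below [a], and the first difference decides. *)
have Adel f : A f -> agr f \/ lt_on J f del.
  move=> Af; have [|nag] := pselect (agr f); [by left|right].
  have [i [Ji fi]] : exists i, J i /\ f i <> del i.
    by apply: contrapT => h; apply: nag => k Jk; apply: contrapT => fk; apply: h; exists k.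
  have [a [b [Aa Bb e]]] := delP _ Ji.
  case/orP: (oler_total a f) => le.
    case: fi; rewrite (e i (lexx _)).2.
    by apply/esym/(hahn_sandwich le (ltW (AB Af Bb)) (fun k ki => (e k ki).1)).
  move: le => /asboolP[fa|[p [fa lt]]]; first by case: fi; rewrite fa (e i (lexx _)).2.
  have pi : (p <= i)%O by rewrite leNgt; apply/negP => /fa fai; apply: fi;
    rewrite fai (e i (lexx _)).2.
  exists p; split; [exact: cut_agree_down pi| |by rewrite (e p pi).2].
  by move=> k kp; rewrite fa // (e k _).2 // (le_trans _ pi) // ltW.
have Bdel f : B f -> agr f \/ lt_on J del f.
  move=> Bf; have [|nag] := pselect (agr f); [by left|right].
  have [i [Ji fi]] : exists i, J i /\ f i <> del i.
    by apply: contrapT => h; apply: nag => k Jk; apply: contrapT => fk; apply: h; exists k.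
  have [a [b [Aa Bb e]]] := delP _ Ji.
  case/orP: (oler_total f b) => le.
    case: fi; rewrite (e i (lexx _)).2.
    by apply/esym/(hahn_sandwich (ltW (AB Aa Bf)) le (fun k ki => (e k ki).1)).
  move: le => /asboolP[fb|[p [fb lt]]].
    by case: fi; rewrite -fb (e i (lexx _)).2 (e i (lexx _)).1.
  have pi : (p <= i)%O.
    rewrite leNgt; apply/negP => /fb fbi; apply: fi.
    by rewrite -fbi (e i (lexx _)).2 (e i (lexx _)).1.
  exists p; split; [exact: cut_agree_down pi| |by rewrite (e p pi).2 (e p pi).1].
  move=> k kp; have ki : (k <= i)%O by rewrite (le_trans _ pi) // ltW.
  by rewrite -fb // (e k ki).2 (e k ki).1.
have [[a0 [Aa0 ag0]]|nA] := pselect (exists a, A a /\ agr a); last first.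
  (* All of [A] is already below at an index of the segment; the negative coefficient puts the new
     element below the elements of [B] that follow [del]. *)
  exists (small_ext_elt del cut_seg (-1 : R)); first exact: small_ext_elt_mem.
  split=> f hf.
    by apply: ext0_lt; left; case: (Adel f hf) => // ag; case: nA; exists f.
  by apply: ext0_gt; case: (Bdel f hf); [right; split=> //; exact: ltrN10|left].
have [[b0 [Bb0 bg0]]|nB] := pselect (exists b, B b /\ agr b); last first.
  exists (small_ext_elt del cut_seg (1 : R)); first exact: small_ext_elt_mem.
  split=> f hf.
    by apply: ext0_lt; case: (Adel f hf); [right; split=> //; exact: ltr01|left].
  by apply: ext0_gt; left; case: (Bdel f hf) => // ag; case: nB; exists f.
have first_diff a b : A a -> agr a -> B b -> agr b -> exists p,
    [/\ ~ J p, forall k, (k < p)%O -> J k & a p < b p].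
  move=> Aa ga Bb gb; have /hahn_ltP[p [ab lt]] := AB Aa Bb; exists p; split=> //.
    by move=> Jp; move: lt; rewrite ga // gb // ltxx.
  move=> k kp; exists a, b; split=> // l lk; apply: ab; exact: le_lt_trans kp.
(* Such a first difference is the least index outside the segment, so it is the same for every
   pair. *)
have [m [nJm Jm _]] := first_diff _ _ Aa0 ag0 Bb0 bg0.
have lt_m a b : A a -> agr a -> B b -> agr b -> a m < b m.
  move=> Aa ga Bb gb; have [p [nJp Jp lt]] := first_diff _ _ Aa ga Bb gb.
  case: (ltgtP p m) => [/Jm //|/Jp //|e]; by subst p.
have [r [rA rB]] : exists r : V, (forall a, A a /\ agr a -> a m <= r) /\
    (forall b, B b /\ agr b -> r <= b m).
  have [|||r [rA rB]] := @realgrp_between R [set a m | a in [set a | A a /\ agr a]]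
      [set b m | b in [set b | B b /\ agr b]].
  - by exists (a0 m); exists a0.
  - by exists (b0 m); exists b0.
  - by move=> _ _ [a [Aa ga] <-] [b [Bb gb] <-]; apply: lt_m.
  exists r; split=> [a h|b h]; first by apply: rA; exists a.
  by apply: rB; exists b.
have wom : wo_chain <=%O [pred k : I | (if k == m then r else 0 : V) != 0].
  apply/wo_chainP => X hX [x Xx]; exists x => // y Xy.
  have em z : X z -> z = m by move=> /hX; rewrite inE; case: (z =P m) => //= _; rewrite eqxx.
  by rewrite (em _ Xx) (em _ Xy).
pose del1 : H := del + Hahn wom.
have del1E k : del1 k = del k + (if k == m then r else 0) by [].
have del1m : del1 m = r by rewrite del1E eqxx del0 // add0r.
have ltm j : J j -> (j < m)%O.
  by move=> Jj; rewrite ltNge; apply/negP => /(cut_agree_down Jj).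
have del1J k : J k -> del1 k = del k.
  by move=> /ltm km; rewrite del1E (lt_eqF km) addr0.
have Sdown i j : (j <= m)%O -> (i <= j)%O -> (i <= m)%O by move=> jm ij; apply: le_trans jm.
pose S : initSeg I := @InitSeg _ I [set k | (k <= m)%O] Sdown.
have agS f : agr f -> f m = r -> forall k, (S : set I) k -> f k = del1 k.
  move=> ag fm k; rewrite -[_ k]/(is_true (k <= m)%O) => km.
  case: (ltgtP k m) km => // [km|->] _; last by rewrite del1m.
  by rewrite del1J ?ag //; apply: Jm.
(* If an element of [A] reaches [r] at [m], no competing element of [B] does, by [lt_m]; so one sign
   suits both sides. *)
pose c : V := if pselect (exists a, [/\ A a, agr a & a m = r]) then 1 else -1 : R.
exists (small_ext_elt del1 S c); first exact: small_ext_elt_mem.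
split=> f hf.
  apply: ext0_lt; case: (Adel f hf) => [ag|[j [Jj e lt]]]; last first.
    left; exists j; split; [exact/ltW/ltm| |by rewrite del1J].
    by move=> k kj; rewrite e // del1J //; apply: cut_agree_down (ltW kj).
  have [fm|/eqP ne] := pselect (f m = r).
    right; split; first exact: agS.
    by rewrite /c; case: pselect => /= [_|[]]; [exact: ltr01|exists f].
  left; exists m; split; [exact: lexx| |by rewrite del1m lt_neqAle ne rA].
  by move=> k km; rewrite del1J ?ag //; apply: Jm.
apply: ext0_gt; case: (Bdel f hf) => [ag|[j [Jj e lt]]]; last first.
  left; exists j; split; [exact/ltW/ltm| |by rewrite del1J].
  by move=> k kj; rewrite -e // del1J //; apply: cut_agree_down (ltW kj).
have [fm|/eqP ne] := pselect (f m = r).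
  right; split; first exact: agS.
  rewrite /c; case: pselect => /= [[a [Aa ga am]]|_]; last exact: ltrN10.
  by have := lt_m _ _ Aa ga hf ag; rewrite am fm ltxx.
left; exists m; split; [exact: lexx| |by rewrite del1m lt_neqAle eq_sym ne rB].
by move=> k km; rewrite del1J ?ag //; apply: Jm.
Qed.

End CutExists.
End Cut.

(** * The bijection *)


Lemma olt_mono (L L' : orderedZmodType) (f : L -> L') :
  {homo f : x y / x < y} -> {mono f : x y / x <= y}.
Proof.
move=> flt x y; apply/idP/idP => [|]; last first.
  by rewrite le_eqVlt => /orP[/eqP -> //|/flt /ltW].
by apply: contraTT; rewrite -!oltNge => /flt.
Qed.

Lemma oltMn2r (L : orderedZmodType) (x y : L) n : (x *+ n.+1 < y *+ n.+1) = (x < y).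
Proof. by rewrite !oltNge olerMn2r. Qed.

(** * Embeddings, supports and divisibility of Hahn products *)

Section HahnEmbeddings.
Variables (d : Order.disp_t) (I : orderType d).

Lemma hahn_mapD (Q Q' : I -> orderedZmodType) (e : forall i, ordEmb (Q i) (Q' i)) :
  {morph hahn_map e : f g / f + g}.
Proof. by move=> f g; apply: hahn_eq => i /=; rewrite emb_add. Qed.

Lemma hahn_map_lt (Q Q' : I -> orderedZmodType) (e : forall i, ordEmb (Q i) (Q' i)) :
  {homo hahn_map e : f g / f < g}.
Proof.
move=> f g /hahn_ltP [i [eq lt]]; apply/hahn_ltP; exists i; split=> [j /eq /= ->//|/=].
by rewrite (leW_mono (emb_le (e i))).
Qed.

Lemma ext0D (V : orderedZmodType) : {morph @ext0 d I V : f g / f + g}.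
Proof. by move=> f g; apply: hahn_eq => -[i|T] //=; rewrite addr0. Qed.

Lemma ext0_homo (V : orderedZmodType) : {homo @ext0 d I V : f g / f < g}.
Proof.
move=> f g /hahn_ltP [i [eq lt]]; apply/hahn_ltP; exists (Elt i); split=> // -[j|T] //= ji.
by apply: eq; move: ji; rewrite !ltNge.
Qed.

Lemma hahn_on_subgroup (V : orderedZmodType) (S : initSeg I) :
  subgroup (@hahn_on d I V S).
Proof.
split=> [x|f g hf hg x]; first by rewrite eqxx.
have [f0|/hf //] := eqVneq (f x) 0.
rewrite -[(f - g) x]/(f x - g x) f0 sub0r oppr_eq0; exact: hg.
Qed.

Lemma hahn_on_pure (V : orderedZmodType) (S : initSeg I) f n :
  @hahn_on d I V S (f *+ n.+1) -> hahn_on S f.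
Proof.
move=> h x fx; apply: h; rewrite hahnMn; apply: contra_neq fx => e.
by apply/eqP; rewrite -(omulrIn n) mul0rn e.
Qed.

Lemma hahn_on_ext0 (V : orderedZmodType) (S : initSeg I) f : @hahn_on d I V S (ext0 f).
Proof. by move=> [i|T] //=; rewrite eqxx. Qed.

Lemma hahn_divisible (R : realType) (f : hahn (fun _ : I => realgrp R)) n :
  exists g, g *+ n.+1 = f.
Proof.
have wo : wo_chain <=%O [pred i | ((f i : R) / n.+1%:R : realgrp R) != 0].
  apply/wo_chainP => B hB B0; apply: (wo_chain_min (B := B) (hahn_wo f)) => // x /hB.
  rewrite !inE; apply: contra_neq => ->; exact: mul0r.
exists (Hahn wo); apply: hahn_eq => i; rewrite hahnMn /=.
rewrite -[LHS]/(((f i : R) / n.+1%:R) *+ n.+1) -[in LHS]mulr_natr divfK //.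
by rewrite pnatr_eq0.
Qed.

End HahnEmbeddings.

Lemma sme_equiv_refl (L : orderedZmodType) (X : set L) b : sme_equiv X b b.
Proof. by exists id => //; split=> //; split=> // x Xx; exists x. Qed.

(** * Key polynomials of non-maximal valuations *)

Section KeyExists.
Variables (K : fieldType) (G L : orderedZmodType) (v : valuation K G) (i : G -> L).
Implicit Types mu nu : valuation {poly K} L.

(** A polynomial of least degree on which [mu] and [nu] differ, made monic, fits [key_of_le];
    scaling is harmless as both extend [v]. *)
Lemma key_exists mu nu : tree v i mu -> tree v i nu -> vle mu nu -> nu <> mu ->
  exists phi, key_poly mu phi.
Proof.
move=> mu_tree nu_tree le ne.
have exn : exists n, `[< exists f : {poly K}, size f = n /\ mu f <> nu f >].
  apply: contrapT => h; apply: ne; apply: valuation_eq => f; apply: contrapT => nef.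
  by apply: h; exists (size f); apply/asboolP; exists f; split=> // e; apply: nef.
case: (ex_minnP exn) => n /asboolP[f [sf nef]] hmin.
have f0 : f != 0 by apply/eqP => e; apply: nef; rewrite e !Defs.val0.
have lc0 : lead_coef f != 0 by rewrite lead_coef_eq0.
pose c := (lead_coef f)^-1; have c0 : c != 0 by rewrite invr_eq0.
have mon : c *: f \is monic by rewrite monicE lead_coefZ mulVf.
exists (c *: f); apply: (@key_of_le _ _ mu nu) => //.
  rewrite lt_neqAle le andbT; apply/eqP; rewrite -!mul_polyC => e; apply: nef.
  have ef : f = (lead_coef f)%:P * (c%:P * f).
    by rewrite mulrA -polyCM mulfV // mul1r.
  by rewrite ef !(Defs.valM _ (lead_coef f)%:P) e mu_tree nu_tree.
move=> g; rewrite size_scale // sf => sg; apply: contrapT => neg.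
suff : (n <= size g)%N by rewrite leqNgt sg.
by apply/hmin/asboolP; exists g; split=> // e; apply: neg.
Qed.

(** A key polynomial has nonzero initial term, hence finite value. *)
Lemma singular_value_finite mu : (exists phi, key_poly mu phi) ->
  exists phi x, mu phi = Some x /\ singular_value mu = Some x.
Proof.
move=> [phi0 kphi0].
have exn : exists n, `[< exists f : {poly K}, size f = n /\ key_poly mu f >].
  by exists (size phi0); apply/asboolP; exists phi0.
case: (ex_minnP exn) => n /asboolP[f [sf kf]] hmin.
rewrite /singular_value; case: xgetP => [a _ [phi [kphi _ ea]]|h].
  case: kphi => _ _ [+ _ _]; case E: (mu phi) => [x|]; last by rewrite initial_None // eqxx.
  by exists phi, x; rewrite ea E.
case: (h (mu f)); exists f; split=> // psi kpsi; rewrite sf.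
by apply/hmin/asboolP; exists psi.
Qed.

End KeyExists.

Section Main.
Variables (R : realType) (K : fieldType) (G : orderedZmodType)
  (v : valuation K G) (v_surj : forall g : G, exists a : K, v a = Some g)
  (d : Order.disp_t) (I : orderType d).
Local Notation H := (hahn (fun _ : I => realgrp R)).
Local Notation L := (hahn (fun _ : bigI I => realgrp R)).
Variable E : G -> H.
Hypotheses (ED : {morph E : x y / x + y}) (E_lt : {homo E : x y / x < y}).
Let j (g : G) : L := ext0 (E g).
Local Notation C := (torsion_over j).
Implicit Types mu nu : valuation {poly K} L.

Let jD : {morph j : x y / x + y}.
Proof. by move=> x y; rewrite /j ED ext0D. Qed.
Let j_le : {mono j : x y / x <= y}.
Proof. by apply: olt_mono => x y /E_lt; apply: ext0_homo. Qed.
Let j0 : j 0 = 0. Proof. exact: (@add_on0 _ _ setT). Qed.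
Let jN g : j (- g) = - j g. Proof. exact: (@add_onN _ _ setT). Qed.

Lemma incommensurable_not_leaf mu phi gam : tree0 v j mu ->
  phi \is monic -> mu phi = Some gam -> ~ C gam ->
  (forall (f : {poly K}) x, (size f < size phi)%N -> mu f = Some x -> C x) ->
  ~ leaf (tree0 v j) mu.
Proof.
move=> [mu_tree [S muS]] mon ephi nC phi_min [_ mu_max].
have [nu nuE le] := mod_valuation jD mu_tree mon ephi nC phi_min.
have sp := size_generator mu_tree ephi nC.
have : nu = mu.
  apply: mu_max => //; split=> [a|].
    by rewrite nuE modp_small // (leq_ltn_trans (size_polyC_leq1 a)).
  exists S; apply: subset_trans muS; apply: gen_subgroup_sub.
    exact: gen_subgroup_subgroup.
  by move=> x [f]; rewrite nuE => /val_valueP.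
by move=> e; have := nuE phi; rewrite modpp Defs.val0 e ephi.
Qed.

Section Representatives.
Variable Gsme : set L.
Hypothesis Gsme_repr : sme_representatives (range j) (@small_ext_reals d I (realgrp R)) Gsme.

Lemma tree_sme0 mu : tree_sme v j Gsme mu -> tree0 v j mu.
Proof. by case=> [[]|[[]]]. Qed.

Lemma incommensurable_sme mu phi gam : tree_sme v j Gsme mu ->
  phi \is monic -> mu phi = Some gam -> ~ C gam ->
  (forall (f : {poly K}) x, (size f < size phi)%N -> mu f = Some x -> C x) ->
  Gsme gam.
Proof.
move=> mu_sme mon ephi nC phi_min; have mu0 := tree_sme0 mu_sme.
have nl := incommensurable_not_leaf mu0 mon ephi nC phi_min.
case: mu_sme => [//|[_ [g sg Gg]]].
move: sg; rewrite (singular_value_generator jD mu0.1 mon ephi nC phi_min) => -[->] //.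
Qed.

(** An isomorphism fixing the value group of [v] fixes everything torsion over it, so [x] is its own
    representative. *)
Lemma torsion_sme x S : C x -> hahn_on S x -> Gsme x.
Proof.
move=> [n [g e]] Sx.
have [c [[Gc [f [_ fD _] [fj fx]]] _]] := Gsme_repr.2 x (ex_intro2 _ _ S Logic.I Sx).
suff <- : c = x by [].
apply/eqP; rewrite -(omulrIn n) -fx -(add_onMn (@gen_subgroup_subgroup _ _) fD).
  by rewrite e fj //; exists g.
by apply: sub_gen_subgroup; right.
Qed.

Lemma tree_sme_inj mu nu : tree_sme v j Gsme mu -> tree_sme v j Gsme nu ->
  vequiv mu nu -> mu = nu.
Proof.
move=> mu_sme nu_sme [f f_iso fE].
have [[mu_tree _] [nu_tree _]] := (tree_sme0 mu_sme, tree_sme0 nu_sme).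
have sX : subgroup (value_group mu) by exact: gen_subgroup_subgroup.
have [_ fD f_le] := f_iso.
have jX g : value_group mu (j g).
  by have [a ea] := v_surj g; apply: (@val_valueP _ _ _ a%:P); rewrite mu_tree ea.
have fj g : f (j g) = j g.
  have [a ea] := v_surj g; have := fE a%:P.
  by rewrite nu_tree mu_tree ea /= => -[].
have fC x : value_group mu x -> C x -> f x = x.
  move=> Xx [n [g e]]; apply/eqP; rewrite -(omulrIn n) -(add_onMn sX fD) // e.
  by rewrite fj.
apply: valuation_eq => p; rewrite fE.
have [ex|nex] := pselect (exists q x, mu q = Some x /\ ~ C x); last first.
  case ep : (mu p) => [x|] //=; rewrite fC //; first exact: val_valueP ep.
  by apply: contrapT => nC; apply: nex; exists p, x.
have [phi [gam [mon ephi nC phi_min]]] := generator_exists jD mu_tree ex.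
have Xgam : value_group mu gam by apply: val_valueP ephi.
(* The same [phi] is a generator for [nu], with value [f gam]. Both values are therefore
   representatives, and [f] itself witnesses their sme-equivalence. *)
have fgam : f gam = gam.
  have Gg := incommensurable_sme mu_sme mon ephi nC phi_min.
  have Gfg : Gsme (f gam).
    apply: (@incommensurable_sme nu phi) => //; first by rewrite fE ephi.
      move=> [n [g e]]; apply: nC; exists n, g; case: f_iso => -[_ f_inj _] _ _.
      apply: f_inj; [exact: mem_set (subgroupMn _ sX Xgam)|exact: mem_set (jX g)|].
      by rewrite (add_onMn sX fD) // e fj.
    move=> q x sq; rewrite fE; case eq : (mu q) => [y|] //= [<-].
    have Cy := phi_min _ _ sq eq; rewrite fC //; exact: val_valueP eq.
  have [c [_ c_uniq]] := Gsme_repr.2 gam (Gsme_repr.1 _ Gg).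
  have ec : c = gam by apply: c_uniq; split=> //; apply: sme_equiv_refl.
  rewrite -[RHS]ec; apply/esym/c_uniq; split=> //; exists f; last first.
    by split=> // _ [g _ <-].
  have ZX : range j `|` [set gam] `<=` value_group mu.
    by move=> _ [[g _ <-]|->].
  have <- : f @` (range j `|` [set gam]) = range j `|` [set f gam].
    apply/seteqP; split=> [_ [_ [[g _ <-]|->] <-]|_ [[g _ <-]|->]].
    - by left; rewrite fj; exists g.
    - by right.
    - by exists (j g) => //; left; exists g.
    - by exists gam => //; right.
  rewrite -(gen_subgroup_image sX fD ZX); apply: ordered_iso_sub f_iso _.
  exact: gen_subgroup_sub.
have [->|p0] := eqVneq p 0; first by rewrite Defs.val0.
(* Every finite value is a torsion element plus a multiple of [gam], and [f] fixes both. *)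
have [c [k [Cc ep]]] := value_decomposition jD mu_tree mon ephi nC phi_min p0.
have Xk : value_group mu (gam *+ k) by exact: subgroupMn sX Xgam.
have Xc : value_group mu c.
  by rewrite -(addrK (gam *+ k) c); apply: sX.2 => //; apply: val_valueP ep.
by rewrite ep /= fD // (add_onMn sX fD) // fgam fC.
Qed.

(** If [mu] is not a leaf, a larger valuation yields a key polynomial; the singular value is
    torsion, hence a representative. *)
Lemma commensurable_sme mu : tree0 v j mu ->
  (forall f x, mu f = Some x -> C x) -> tree_sme v j Gsme mu.
Proof.
move=> mu0 mu_C; have [|nleaf] := pselect (leaf (tree0 v j) mu); [by left|right].
split=> //.
have [nu [[nu_tree _] le ne]] : exists nu, [/\ tree0 v j nu, vle mu nu & nu <> mu].
  apply: contrapT => h; apply: nleaf; split=> // nu nu0 le; apply: contrapT => ne.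
  by apply: h; exists nu.
have [phi [x [ephi ->]]] := singular_value_finite (key_exists mu0.1 nu_tree le ne).
have [S muS] := mu0.2; exists x => //; apply: (@torsion_sme _ S); first exact: mu_C ephi.
by apply: muS; apply: val_valueP ephi.
Qed.

(** * Surjectivity: realising an abstract extension inside [L] *)

Section Extension.
Variables (W : orderedZmodType) (i : G -> W).
Hypotheses (iD : {morph i : x y / x + y}) (i_le : {mono i : x y / x <= y}).
Let iN g : i (- g) = - i g. Proof. exact: (@add_onN _ _ setT). Qed.
Let i0 : i 0 = 0. Proof. exact: (@add_on0 _ _ setT). Qed.
Let iMn g n : i (g *+ n) = i g *+ n. Proof. exact: (@add_onMn _ _ setT). Qed.

(** The cut made by [b] is copied to the divisible hull of the image of [E], and [small_ext_cut]
    fills it strictly. *)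
Lemma cut_realization b : ~ torsion_over i b -> exists2 gam : L, small_ext_reals gam &
  forall g n, (i g < b *+ n.+1 /\ j g < gam *+ n.+1) \/
              (b *+ n.+1 < i g /\ gam *+ n.+1 < j g).
Proof.
move=> nC; have neq g n : i g != b *+ n.+1.
  by apply/eqP => e; apply: nC; exists n, g.
pose side P := [set f : H | exists g n, f *+ n.+1 = E g /\ P (i g) (b *+ n.+1)].
have [|gam gam_sme [gamA gamB]] := @small_ext_cut d I R
    (side (fun x y => x < y)) (side (fun x y => y < x)).
  move=> f f' [g [n [ef lt]]] [g' [n' [ef' lt']]].
  (* Multiplying by both denominators moves the comparison into [G], where it passes through a
     multiple of [b]. *)
  rewrite -(oltMn2r _ _ (n + n' + n * n')).
  have -> : ((n + n' + n * n').+1 = n.+1 * n'.+1)%N by lia.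
  have EMn k l : E (k *+ l) = E k *+ l by exact: (@add_onMn _ _ setT).
  rewrite mulrnA ef [in ltRHS]mulnC mulrnA ef' -!EMn; apply: E_lt.
  rewrite -(leW_mono i_le) !iMn; apply: (@lt_trans _ _ (b *+ n.+1 *+ n'.+1)).
    by rewrite oltMn2r.
  by rewrite mulrnAC oltMn2r.
exists gam => // g n.
have [f ef] := hahn_divisible (E g) n.
have efj : ext0 f *+ n.+1 = j g.
  by rewrite /j -ef; apply/esym/(@add_onMn _ _ setT) => // ? ? _ _; apply: ext0D.
case/orP: (oler_total (i g) (b *+ n.+1)) => le; [left|right].
  have lt : i g < b *+ n.+1 by rewrite lt_neqAle neq.
  by split=> //; rewrite -efj oltMn2r; apply: gamA; exists g, n.
have lt : b *+ n.+1 < i g by rewrite lt_neqAle eq_sym neq.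
by split=> //; rewrite -efj oltMn2r; apply: gamB; exists g, n.
Qed.

(** The cut determines all signs: for [m = 0] the embeddings decide, for [m > 0] the position of
    [- g], for [m < 0] that of [g]. *)
Lemma cut_ge0 b gam :
  (forall g n, (i g < b *+ n.+1 /\ j g < gam *+ n.+1) \/
               (b *+ n.+1 < i g /\ gam *+ n.+1 < j g)) ->
  forall g m, (0 <= i g + b *~ m) = (0 <= j g + gam *~ m).
Proof.
move=> cut g; case=> [[|n]|n].
- by rewrite !mulr0z !addr0 -[in LHS]i0 -[in RHS]j0 i_le j_le.
- have e (V : orderedZmodType) (x y : V) : (0 <= x + y) = (- x <= y).
    by rewrite -(osubr_ge0 (- x)) opprK addrC.
  rewrite -!pmulrn !e -iN -jN.
  case: (cut (- g) n) => [[l1 l2]|[]]; first by rewrite !ltW.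
  by rewrite !oltNge => /negbTE-> /negbTE->.
- rewrite !NegzE !mulrNz -!pmulrn !osubr_ge0.
  case: (cut g n) => [[]|[l1 l2]]; last by rewrite !ltW.
  by rewrite !oltNge => /negbTE-> /negbTE->.
Qed.

(** The isomorphism behind [sme_equiv] preserves all these signs, so the filling element may be
    replaced by its representative. *)
Lemma cut_sme b : ~ torsion_over i b -> exists2 c : L, Gsme c &
  forall g m, (0 <= i g + b *~ m) = (0 <= j g + c *~ m).
Proof.
move=> /cut_realization[gam gam_sme /cut_ge0 cut].
have [c [[Gc [f [_ fD f_le] [fj fx]]] _]] := Gsme_repr.2 _ gam_sme.
exists c => // g m; rewrite cut.
set X := gen_subgroup _ in fD f_le.
have sX : subgroup X by exact: gen_subgroup_subgroup.
have Xj : X (j g) by apply: sub_gen_subgroup; left; exists g.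
have Xgam : X gam by apply: sub_gen_subgroup; right.
have Xm := subgroupMz m sX Xgam.
rewrite -f_le; [|exact: sX.1|exact: subgroupD sX Xj Xm].
by rewrite (add_on0 sX fD) fD // (add_onMz sX fD) // fx fj //; exists g.
Qed.

Lemma tree_sme_surj (w : valuation {poly K} W) : tree v i w ->
  exists2 mu, tree_sme v j Gsme mu & vequiv w mu.
Proof.
move=> w_tree.
(* On constants the relation with [m = 0] pins down the value; all other values have a multiple
   supported in [S] and the old indices, hence are so supported themselves. *)
have transfer b c (mu : valuation {poly K} L) S :
    (forall g m, (0 <= i g + b *~ m) = (0 <= j g + c *~ m)) -> hahn_on S c ->
    (forall f, match w f with None => mu f = None
      | Some x => exists2 z, mu f = Some z & torsion_rel i j b c x z end) ->
    tree0 v j mu.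
  move=> bc Sc muw; split=> [a|].
    have := muw a%:P; rewrite w_tree; case: (v a) => [g|] //= [z -> rel].
    congr Some; apply: (torsion_rel_fun iD jD bc rel).
    by have := torsion_rel_base i j b c g 0; rewrite !mulr0z !addr0.
  have sS := hahn_on_subgroup (realgrp R) S.
  exists S; apply: gen_subgroup_sub => // x [f]; have := muw f.
  case: (w f) => [y [z -> [n [g [m [_ e]]]]] [<-]|-> //].
  apply: (@hahn_on_pure _ _ _ _ _ n); rewrite e.
  exact: subgroupD sS (@hahn_on_ext0 _ _ _ S (E g)) (subgroupMz m sS Sc).
have [ex|nex] := pselect (exists f x, w f = Some x /\ ~ torsion_over i x).
  have [phi [b [mon ephi nC phi_min]]] := generator_exists iD w_tree ex.
  have [c Gc bc] := cut_sme nC.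
  have [S _ Sc] := Gsme_repr.1 _ Gc.
  have [|mu [w_mu muw]] := valuation_transfer iD jD bc (@hahn_divisible _ _ R) (w := w).
    move=> f x ef; have f0 : f != 0 by apply/eqP => e; move: ef; rewrite e Defs.val0.
    have [x' [k [[n [g ex']]]]] := value_decomposition iD w_tree mon ephi nC phi_min f0.
    rewrite ef => -[->]; exists n, g, (k * n.+1)%N%:Z.
    by rewrite mulrnDl ex' -pmulrn mulrnA.
  have mu0 := transfer b c mu S bc Sc muw.
  have mu_phi : mu phi = Some c.
    have := muw phi; rewrite ephi => -[z -> rel]; congr Some.
    apply: (torsion_rel_fun iD jD bc rel).
    by have := torsion_rel_base i j b c 0 1; rewrite i0 j0 !mulr1z !add0r.
  (* If (n+1)c = [j g], then by [bc] both [i g] - (n+1)b and its opposite are nonnegative, and [b]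
     would be torsion. *)
  have cC : ~ C c.
    move=> [n [g e]]; apply: nC; exists n, g; apply/eqP.
    rewrite eq_le -osubr_ge0 -[X in _ && X]osubr_ge0.
    have -> : i g - b *+ n.+1 = i g + b *~ (Negz n) by rewrite NegzE mulrNz -pmulrn.
    have -> : b *+ n.+1 - i g = i (- g) + b *~ n.+1 by rewrite iN addrC -pmulrn.
    by rewrite !bc NegzE mulrNz -pmulrn jN e subrr addNr lexx.
  have mu_min (f : {poly K}) x : (size f < size phi)%N -> mu f = Some x -> C x.
    move=> sf; have := muw f; case ef: (w f) => [y|]; last by move=> ->.
    move=> [z -> rel] [<-]; have [n [g ey]] := phi_min _ _ sf ef.
    have [t et] := hahn_divisible (j g) n.
    exists n, g; rewrite -et; congr (_ *+ _).
    apply: (torsion_rel_fun iD jD bc rel); exists n, g, 0.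
    by rewrite !mulr0z !addr0.
  exists mu => //; right; split; last first.
    exists c => //; exact (singular_value_generator jD mu0.1 mon mu_phi cC mu_min).
  by split=> //; exact: incommensurable_not_leaf mu0 mon mu_phi cC mu_min.
have w_C f x : w f = Some x -> torsion_over i x.
  by move=> ef; apply: contrapT => nC; apply: nex; exists f, x.
(* In the commensurable case [b = c = 0], so the torsion relation involves [G] alone. *)
have bc g m : (0 <= i g + 0 *~ m) = (0 <= j g + 0 *~ m).
  by rewrite !mul0rz !addr0 -[in LHS]i0 -[in RHS]j0 i_le j_le.
have [|mu [w_mu muw]] := valuation_transfer iD jD bc (@hahn_divisible _ _ R) (w := w).
  by move=> f x /w_C[n [g e]]; exists n, g, 0; rewrite mulr0z addr0.
pose S : initSeg I := @InitSeg _ I setT (fun _ _ _ _ => Logic.I).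
have mu0 := transfer 0 0 mu S bc (hahn_on_subgroup (realgrp R) S).1 muw.
exists mu => //; apply: commensurable_sme => // f x.
have := muw f; case ef: (w f) => [y|]; last by move=> ->.
move=> [z -> [n [g [m [_ e]]]]] [<-]; exists n, g.
by rewrite e mul0rz addr0.
Qed.

End Extension.

End Representatives.
End Main.

Theorem theorem7p1 (R : realType) (K : fieldType) (G : orderedZmodType)
    (v : valuation K G) (v_surj : forall g : G, exists a : K, v a = Some g)
    (d : Order.disp_t) (I : orderType d) (s : skeleton (divHull G) I)
    (h : ordEmb (divHull G) (hahn (sk_quot s)))
    (h_skel : induces_skeleton_iso h)
    (e : forall i : I, ordEmb (sk_quot s i) (realgrp R))
    (e_one : forall i : I, exists2 q : sk_quot s i, 0 < q & e i q = (1 : R))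
    (Gsme : set (hahn (fun _ : bigI I => realgrp R)))
    (Gsme_repr : sme_representatives (range (real_embedding h e))
       (@small_ext_reals d I (realgrp R)) Gsme) :
  bijection_on (tree_sme v (real_embedding h e) Gsme) (tree_v v)
    (fun mu => vclass mu).
Proof.
pose E g := hahn_map e (h (to_divHull G g)).
have ED : {morph E : x y / x + y} by move=> x y; rewrite /E !emb_add hahn_mapD.
have E_lt : {homo E : x y / x < y}.
  by move=> x y xy; apply: hahn_map_lt; rewrite !(leW_mono (emb_le _)).
(* This turns an equivalence of [v] with the restriction of [w] into an embedding of all of [G]. *)
have val_v : value_group v = setT.
  apply/seteqP; split=> // g _; have [a ea] := v_surj g.
  by apply: sub_gen_subgroup; exists a.
split=> [mu mu_sme|mu nu mu_sme nu_sme /vequiv_vclass|y [w [[i [_ iD i_le] iE] ->]]].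
- exists (AnyValuation mu); split=> //.
  have mu_tree := (tree_sme0 mu_sme).1.
  apply: (@vequiv_map _ _ _ _ _ (real_embedding h e)) => [x y _ _|x y _ _|a].
  + by rewrite /real_embedding -/(E _) ED ext0D.
  + by apply: (olt_mono (f := fun g => ext0 (E g))) => {x y} x y /E_lt; apply: ext0_homo.
  + exact: mu_tree.
- exact: (@tree_sme_inj _ _ _ _ v_surj _ _ E ED _ Gsme_repr).
- rewrite val_v in iD i_le.
  have [mu mu_sme w_mu] : exists2 mu, tree_sme v (fun g => ext0 (E g)) Gsme mu & vequiv w mu.
    by apply: (@tree_sme_surj _ _ _ _ _ _ _ ED E_lt _ Gsme_repr _ i) => // x z;
      [apply: iD|apply: i_le].
  by exists mu => //; apply/vequiv_vclass/vequiv_sym.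
Qed.
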